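(* Let $J_0$ be a two-sided $p$-periodic Jacobi matrix and let $J$ be a one-sided Jacobi matrix with bounded Jacobi parameters all of whose right limits lie in $\mathcal{T}_{J_0}$. Let $\mu$ be the spectral measure of $J$ and $\{p_n\}_{n\ge0}$ its orthonormal polynomials. Then (a) $\frac1p\sum_{j=1}^p|p_{j+n}(x)|^2\,d\mu(x)\to d\nu$ weakly as $n\to\infty$; (b) the zero counting measures of $p_n$ (assigning weight $1/n$ to each zero of $p_n$) converge weakly to $\nu$.
   Context: A one-sided Jacobi matrix $J$ acts on $\ell^2(\{1,2,\dots\})$ with $J_{nn}=b_n\in\mathbb{R}$, $J_{n,n+1}=J_{n+1,n}=a_n>0$; $\mu$ satisfies $\langle\delta_1,f(J)\delta_1\rangle=\int f\,d\mu$, and $p_n$ are the orthonormal polynomials in $L^2(\mu)$ with positive leading coefficients, $p_0=1$. A right limit of $J$ is a two-sided sequence $\{(a^r_k,b^r_k)\}_{k\in\mathbb{Z}}$ (some $a^r_k$ possibly $0$) such that for some $n_j\to\infty$, $a_{n_j+k}\to a^r_k$ and $b_{n_j+k}\to b^r_k$ for every $k\in\mathbb{Z}$. For the $p$-periodic two-sided Jacobi matrix $J_0$ with parameters $a^{(0)}_n,b^{(0)}_n$, the discriminant is $\Delta(x)=\mathrm{Tr}(\Lambda_p(x)\cdots\Lambda_1(x))$, $\Lambda_n(x)=\frac1{a^{(0)}_n}\begin{pmatrix}x-b^{(0)}_n&-1\\(a^{(0)}_n)^2&0\end{pmatrix}$; $\sigma(J_0)=\Delta^{-1}([-2,2])$;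 $\mathcal{T}_{J_0}$ is the set of two-sided $p$-periodic Jacobi parameter sequences with discriminant $\Delta$. $\nu$ is the density of states (harmonic measure) of $\sigma(J_0)$: $d\nu(x)=\frac{2}{p}\frac{|\Delta'(x)|}{\sqrt{4-\Delta(x)^2}}\frac{dx}{2\pi}$ on $\sigma(J_0)$. *)

(* Defs.v *)
From HB Require Import structures.
From mathcomp Require Import all_boot all_order all_algebra.
From mathcomp Require Import all_classical all_reals all_analysis.
Set Implicit Arguments.
Unset Strict Implicit.
Unset Printing Implicit Defensive.
Import Order.TTheory GRing.Theory Num.Theory.
Import numFieldNormedType.Exports.
Local Open Scope classical_set_scope.
Local Open Scope ring_scope.

Section Defs.
Variable R : realType.

(* One-sided Jacobi parameters are stored 0-based: a i = a_{i+1}, b i = b_{i+1};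
   l^2(nat) index i corresponds to delta_{i+1}. *)

Definition jacobi_apply (a b : nat -> R) (v : nat -> R) : nat -> R :=
  fun n => b n * v n + a n * v n.+1 + (if n is m.+1 then a m * v m else 0).

Definition delta0 : nat -> R := fun n => if n is 0 then 1 else 0.

Definition jacobi_moment (a b : nat -> R) (k : nat) : R :=
  iter k (jacobi_apply a b) delta0 0%N.

(* extension of a one-sided sequence to Z (values at negative indices are
   irrelevant for right limits) *)
Definition extZ (a : nat -> R) (z : int) : R :=
  if (0 <= z)%R then a `|z|%N else 0.

Definition is_right_limit (a b : nat -> R) (ar br : int -> R) : Prop :=
  exists nj : nat -> nat,
    (forall M : nat, exists N : nat, forall j : nat, (N <= j)%N -> (M <= nj j)%N) /\
    forall k : int,
      ((fun j => extZ a ((nj j)%:Z + k)) @ \oo --> ar k) /\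
      ((fun j => extZ b ((nj j)%:Z + k)) @ \oo --> br k).

Definition transfer (a0 b0 : int -> R) (n : int) : 'M[{poly R}]_2 :=
  \matrix_(i, j)
    (((a0 n)^-1)%:P *
      (if (i == 0 :> nat) && (j == 0 :> nat) then 'X - (b0 n)%:P
       else if (i == 0 :> nat) && (j == 1 :> nat) then -1
       else if (i == 1 :> nat) && (j == 0 :> nat) then ((a0 n) ^+ 2)%:P
       else 0)).

Definition discriminant (p : nat) (a0 b0 : int -> R) : {poly R} :=
  \tr (\prod_(i < p) transfer a0 b0 (p - i)%:Z).

Definition periodic_jacobi (p : nat) (a0 b0 : int -> R) : Prop :=
  (forall n : int, 0 < a0 n) /\
  (forall n : int, a0 (n + p%:Z) = a0 n /\ b0 (n + p%:Z) = b0 n).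

Definition in_isospectral_torus (p : nat) (Delta : {poly R}) (ar br : int -> R) : Prop :=
  periodic_jacobi p ar br /\ discriminant p ar br = Delta.

Definition spectrum_of (Delta : {poly R}) : set R :=
  [set x | -2 <= Delta.[x] <= 2].

Definition dos_density (p : nat) (Delta : {poly R}) (x : R) : R :=
  (2 / p%:R) * `|(Delta^`()).[x]| / Num.sqrt (4 - Delta.[x] ^+ 2) / (2 * pi).

Definition dos_integral (p : nat) (Delta : {poly R}) (f : R -> R) : \bar R :=
  (\int[lebesgue_measure]_(x in spectrum_of Delta) (f x * dos_density p Delta x)%:E)%E.

Definition zero_counting_integral (n : nat) (q : {poly R}) (f : R -> R) : R :=
  (n%:R)^-1 * \sum_(x \in [set x : R | root q x]) f x.

Definition bounded_continuous (f : R -> R) : Prop :=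
  continuous f /\ exists M : R, forall x, `|f x| <= M.

End Defs.

(* Main.v *)
(** Both statements reduce to moments, because [mu], the zeros of [p_n] and
    [nu] live on a common compact interval and polynomials are dense there.
    The [l]-th moment in (a) is the average over one period of the diagonal
    entries of [J^l]; the one in (b) is [tr (J_n^l) / n] for the [n x n]
    truncation [J_n], hence, up to O(1/n), the Cesaro mean of the same diagonal
    entries.  By compactness it is enough to identify the average for a right
    limit, that is for a [p]-periodic Jacobi matrix with discriminant [Delta].

    For such a matrix the transfer matrix over [N] periods is
    [S_N(Delta) T - S_(N-1)(Delta)], with [S_N(2 cos t) = sin (N t) / sin t],
    so the zeros of its orthogonal polynomial of degree [N p - 1] are those of
    degree [p - 1] together with the solutions of [Delta = 2 cos (j pi / N)],
    [0 < j < N].  As truncations are real symmetric, every such equation has [p]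
    simple real solutions, which forces the band structure; and since [nu] is
    the derivative of [arccos (Delta / 2) / (p pi)], these solutions cut each
    band into pieces of mass exactly [1 / (N p)].  Hence the averaged diagonal
    entries of [J^l] are limits of Riemann sums for the integral of [x^l]
    against [nu]. *)
Require Import Defs.
From HB Require Import structures.
From mathcomp Require Import all_boot all_order all_algebra.
From mathcomp Require Import spectral sesquilinear complex.
From mathcomp Require Import polyrcf.
From mathcomp Require Import all_classical all_reals all_analysis measurable_realfun.
From mathcomp Require Import ring lra zify.
Set Implicit Arguments.
Unset Strict Implicit.
Unset Printing Implicit Defensive.
Import Order.TTheory GRing.Theory Num.Theory.
Import numFieldNormedType.Exports.
Local Open Scope classical_set_scope.
Local Open Scope ring_scope.

(** * Entries of powers of a half-line Jacobi matrix *)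

Section JacobiColumns.
Variable R : realType.
Implicit Types (a b v : nat -> R).

(** The density of [nu] is singular at the band edges, and neither the edges nor the critical points
    of [Delta] have a closed form, so [Delta = 2] and [Delta = -2] are never solved. Only the
    heights [2 cos (j pi / N)], strictly between them, are used; even the total mass of [nu] is
    obtained as the limit of [1 - 2 / N], the mass between the extreme heights. The identity for
    degree [N p - 1] concerns the right half of the periodic matrix. Its left end is harmless: the
    [i]-th diagonal entry of [J^l] depends only on parameters within distance [l] of [i], so for
    [i >= l] it is already periodic in [i]. Within a band the cells have bounded total length, so
    the Riemann sums carry an error O(1/N), as do the normalized traces. The two descriptions of the
    power sums over all level points therefore stay at bounded distance while both grow linearly in
    [N], and their slopes agree exactly. As [mu] is given by its moments alone, its support and its
    orthonormal polynomials are recovered from these. *)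

Definition jacobi_col a b (l j : nat) : nat -> R :=
  iter l (jacobi_apply a b) (fun m => (m == j)%:R).

Definition jacobi_diag a b (l i : nat) : R := jacobi_col a b l i i.

Lemma jacobi_colS a b l j :
  jacobi_col a b l.+1 j = jacobi_apply a b (jacobi_col a b l j).
Proof. by []. Qed.

Lemma jacobi_moment_col a b k : jacobi_moment a b k = jacobi_col a b k 0 0%N.
Proof.
rewrite /jacobi_moment /jacobi_col; congr (iter k _ _ _).
by apply/funext => -[|n].
Qed.

Lemma jacobi_col_support a b l j m :
  (m + l < j)%N || (j + l < m)%N -> jacobi_col a b l j m = 0.
Proof.
elim: l m => [|l IH] m H.
  by rewrite /jacobi_col /=; case: eqP => // E; exfalso; lia.
rewrite jacobi_colS /jacobi_apply !IH ?mulr0 ?add0r; try lia.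
by case: m H => [//|m] H; rewrite IH ?mulr0 //; lia.
Qed.

(** A row of [J] has at most three nonzero entries, each at most [M] in absolute value, so each
    application multiplies the supremum by at most [3 * M]. *)
Lemma jacobi_col_bound a b M l j m :
  (forall n, `|a n| <= M /\ `|b n| <= M) ->
  `|jacobi_col a b l j m| <= (3 * M) ^+ l.
Proof.
move=> hM; have M0 : 0 <= M by apply: le_trans (proj1 (hM 0%N)).
elim: l m => [|l IH] m.
  by rewrite /jacobi_col /= expr0; case: eqP; rewrite ?normr1 ?normr0.
have K x y : `|x| <= M -> `|y| <= (3 * M) ^+ l -> `|x * y| <= M * (3 * M) ^+ l.
  by move=> hx hy; rewrite normrM ler_pM.
rewrite jacobi_colS /jacobi_apply exprS.
apply: le_trans (ler_normD _ _) _.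
have := ler_normD (b m * jacobi_col a b l j m) (a m * jacobi_col a b l j m.+1).
have := K _ _ (proj2 (hM m)) (IH m).
have := K _ _ (proj1 (hM m)) (IH m.+1).
have : `|match m with 0%N => 0 | m0.+1 => a m0 * jacobi_col a b l j m0 end|
   <= M * (3 * M) ^+ l.
  case: m => [|m]; first by rewrite normr0 mulr_ge0 // exprn_ge0 // mulr_ge0.
  exact: K (proj1 (hM m)) (IH m).
lra.
Qed.

(** A nearest-neighbour walk of [l] steps from [j] uses no parameter of index [j + l] or more. *)
Lemma jacobi_col_local a b a' b' l j :
  (forall k, (k < j + l)%N -> a k = a' k /\ b k = b' k) ->
  jacobi_col a b l j = jacobi_col a' b' l j.
Proof.
elim: l => [|l IH] H //; rewrite !jacobi_colS -IH; last first.
  by move=> k hk; apply: H; lia.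
apply/funext => m; rewrite /jacobi_apply.
have E k : (k < j + l.+1)%N \/ jacobi_col a b l j k = 0.
  by case: (ltnP k (j + l.+1)) => hk; [left|right; apply: jacobi_col_support; lia].
congr (_ + _ + _).
- by case: (E m) => [/H[_ ->] //|->]; rewrite !mulr0.
- case: (ltnP m (j + l)) => hm; first by have [|-> _] := H m; first lia.
  by rewrite jacobi_col_support ?mulr0 //; lia.
- case: m => [//|m].
  by case: (E m) => [/H[-> _] //|->]; rewrite !mulr0.
Qed.

(** A walk of [l <= i] steps from [i] cannot step past site 0, so the end of the half-line is
    invisible. This lets a half-line matrix stand in for a two-sided one. *)
Lemma jacobi_col_shift a b l i s m : (l <= i)%N ->
  jacobi_col a b l (i + s) (m + s) =
  jacobi_col (fun k => a (k + s)%N) (fun k => b (k + s)%N) l i m.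
Proof.
elim: l m => [|l IH] m hl; first by rewrite /jacobi_col /= eqn_add2r.
rewrite !jacobi_colS /jacobi_apply -!IH ?(ltnW hl) // addSn.
congr (_ + _); case: m => [|m]; last by rewrite addSn IH // ltnW.
case: s {IH} => [//|s]; rewrite add0n jacobi_col_support ?mulr0 //; lia.
Qed.

Lemma jacobi_diag_cvg (a b : nat -> nat -> R) (al be : nat -> R) l i :
  (forall k, (fun n => a n k) @ \oo --> al k) ->
  (forall k, (fun n => b n k) @ \oo --> be k) ->
  (fun n => jacobi_diag (a n) (b n) l i) @ \oo --> jacobi_diag al be l i.
Proof.
(* The row index is freed, since one step of the induction involves the neighbouring rows. *)
move=> ha hb; rewrite /jacobi_diag; move: {2 4}i => m.
elim: l m => [|l IH] m; first exact: cvg_cst.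
rewrite /jacobi_col /=.
apply: cvgD; first by apply: cvgD; apply: cvgM; rewrite //; exact: IH.
case: m => [|m]; first exact: cvg_cst.
by apply: cvgM; [exact: ha | exact: IH].
Qed.

End JacobiColumns.

(** * Polynomials generated by the three-term recurrence *)

Section JacobiPolynomials.
Variable R : realType.
Variables a b : nat -> R.
Hypothesis ha : forall n, 0 < a n.

(* The pair [(p_n, a_{n-1} p_{n-1})], on which one recurrence step acts by the
   matrix [transfer]; the second entry is 0 at [n = 0]. *)
Fixpoint jacobi_pair n : {poly R} * {poly R} :=
  if n is m.+1 then
    ((a m)^-1 *: (('X - (b m)%:P) * (jacobi_pair m).1 - (jacobi_pair m).2),
     a m *: (jacobi_pair m).1)
  else (1, 0).

Definition jacobi_poly n := (jacobi_pair n).1.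

Lemma jacobi_poly_rec n :
  'X * jacobi_poly n = a n *: jacobi_poly n.+1 + b n *: jacobi_poly n
     + (if n is m.+1 then a m *: jacobi_poly m else 0).
Proof.
have an : a n != 0 by rewrite gt_eqF.
rewrite /jacobi_poly /= scalerA divff // scale1r -!mul_polyC.
by case: n an => [|n] an /=; rewrite -?mul_polyC; ring.
Qed.

Lemma size_jacobi_poly n : size (jacobi_poly n) = n.+1.
Proof.
suff : size (jacobi_pair n).1 = n.+1 /\ (size (jacobi_pair n).2 <= n)%N by case.
elim: n => [|n [IH1 IH2]] /=; first by rewrite size_poly1 size_poly0.
have an : a n != 0 by rewrite gt_eqF.
have q0 : (jacobi_pair n).1 != 0 by rewrite -size_poly_eq0 IH1.
rewrite !size_scale ?invr_eq0 // IH1; split => //.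
have sq : size (('X - (b n)%:P) * (jacobi_pair n).1) = n.+2.
  by rewrite size_mul ?polyXsubC_eq0 // size_XsubC IH1.
by rewrite size_polyDl sq // size_polyN ltnS (leq_trans IH2).
Qed.

Lemma jacobi_poly_neq0 n : jacobi_poly n != 0.
Proof. by rewrite -size_poly_eq0 size_jacobi_poly. Qed.

Lemma lead_jacobi_polyS n :
  lead_coef (jacobi_poly n.+1) = (a n)^-1 * lead_coef (jacobi_poly n).
Proof.
have := congr1 (fun q : {poly R} => q`_n.+1) (jacobi_poly_rec n).
rewrite /lead_coef !size_jacobi_poly /= mulrC coefMX /= !coefD !coefZ.
rewrite [in X in _ + b n * X]nth_default ?size_jacobi_poly // mulr0 addr0.
case: n => [|n]; rewrite ?coef0 ?coefZ ?[(jacobi_poly n)`_ _]nth_default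
  ?size_jacobi_poly // ?mulr0 ?addr0 => ->; by rewrite mulKf // gt_eqF.
Qed.

Lemma lead_jacobi_poly_gt0 n : 0 < lead_coef (jacobi_poly n).
Proof.
elim: n => [|n IH]; first by rewrite /jacobi_poly /= lead_coef1.
by rewrite lead_jacobi_polyS mulr_gt0 // invr_gt0.
Qed.

(** On coefficient vectors multiplication by ['X] acts as [J]; cutting the sum at [N] leaves the two
    terms of the bond that joins [N - 1] to [N]. *)
Lemma mulX_jacobi_sum (v : nat -> R) N :
  'X * \sum_(m < N) v m *: jacobi_poly m =
  \sum_(m < N) jacobi_apply a b v m *: jacobi_poly m +
  (if N is k.+1 then (a k * v k) *: jacobi_poly k.+1
     - (a k * v k.+1) *: jacobi_poly k else 0).
Proof.
elim: N => [|N IH]; first by rewrite !big_ord0 mulr0 addr0.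
rewrite !big_ord_recr /= mulrDr IH -scalerAr jacobi_poly_rec /jacobi_apply.
by case: N {IH} => [|N]; rewrite -!mul_polyC ?polyCD ?polyCM; ring.
Qed.

Lemma mulXn_jacobi_poly l j N : (j + l < N)%N ->
  'X^l * jacobi_poly j = \sum_(m < N) jacobi_col a b l j m *: jacobi_poly m.
Proof.
elim: l N => [|l IH] N hN.
  rewrite mul1r (bigD1 (Ordinal (_ : j < N)%N)) /= ?addn0 //; first by lia.
  move=> h; rewrite /jacobi_col /= eqxx scale1r big1 ?addr0 // => i.
  by rewrite -val_eqE /= => /negbTE ->; rewrite scale0r.
rewrite exprS -mulrA (IH N) ?mulX_jacobi_sum ?jacobi_colS; last by lia.
case: N hN => [//|N] hN.
by rewrite !jacobi_col_support ?mulr0 ?scale0r ?subr0 ?addr0 //; lia.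
Qed.

(** The confluent Christoffel-Darboux identity. *)
Lemma jacobi_pair_wronskian n :
  (jacobi_pair n).1^`() * (jacobi_pair n).2 - (jacobi_pair n).1 * (jacobi_pair n).2^`()
  = \sum_(j < n) jacobi_poly j ^+ 2.
Proof.
elim: n => [|n IH]; first by rewrite big_ord0 /= deriv0 !mulr0 subr0.
rewrite big_ord_recr -IH /= /jacobi_poly.
have : (a n)^-1%:P * (a n)%:P = 1 :> {poly R}.
  by rewrite -polyCM mulVf // gt_eqF.
rewrite !derivZ derivB derivM derivXsubC -!mul_polyC => h.
set A := (a n)^-1%:P in h *; set B := (a n)%:P in h *.
set q := (jacobi_pair n).1; set r := (jacobi_pair n).2.
transitivity ((A * B) * (r^`() * (- q) + q^`() * r + q ^+ 2)); first by ring.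
by rewrite h; ring.
Qed.

(** At a double zero the left side of [jacobi_pair_wronskian] would vanish, while its right side is
    at least the square of [p_0 = 1]. *)
Lemma jacobi_poly_simple_root n x :
  root (jacobi_poly n) x -> (jacobi_poly n)^`().[x] != 0.
Proof.
case: n => [|n]; first by rewrite /jacobi_poly /= rootE hornerE oner_eq0.
rewrite rootE => /eqP h0; apply/negP => /eqP h1.
have := congr1 (horner^~ x) (jacobi_pair_wronskian n.+1).
rewrite -/(jacobi_poly _) hornerD hornerN !hornerM h0 h1 !mul0r subr0.
rewrite horner_sum big_ord_recl horner_exp /jacobi_poly /= hornerE expr1n => /eqP.
rewrite lt_eqF // ltr_wpDr // sumr_ge0 // => i _.
by rewrite horner_exp sqr_ge0.
Qed.

End JacobiPolynomials.

(** * Eigenvalues and traces of real symmetric matrices *)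

Section SymmetricSpectrum.
Variable R : rcfType.

(** Over [complex R] the matrix is Hermitian, hence unitarily diagonalizable with real diagonal;
    both identities are read off there and pulled back along the injection of [R]. *)
Lemma symmetric_spectrum n (A : 'M[R]_n) : A^T = A ->
  exists d : 'I_n -> R, char_poly A = \prod_i ('X - (d i)%:P) /\
    forall l, \tr (A ^+ l) = \sum_i d i ^+ l.
Proof.
move=> AT.
pose f : {rmorphism R -> complex R} := @real_complex R.
have f_inj : injective f by move=> x y [].
pose B := map_mx f A.
have Bherm : B \is hermsymmx.
  apply: realsym_hermsym.
    apply/is_hermitianmxP; rewrite expr0 scale1r.
    by apply/matrixP => i j; rewrite !mxE -[in LHS]AT !mxE.
  by apply/mxOverP => i j; rewrite mxE complex_real.
have /orthomx_spectralP := hermitian_normalmx Bherm.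
have /mxOverP := hermitian_spectral_diag_real Bherm.
have := spectral_unit B.
set P := spectralmx B; set sp := spectral_diag B => Pu sp_real BE.
pose d i := complex.Re (sp 0 i).
have dE i : sp 0 i = f (d i) by rewrite [RHS]RRe_real.
exists d; split.
  apply: (map_inj_poly f_inj (rmorph0 f)).
  rewrite map_char_poly -/B rmorph_prod /=.
  have -> : char_poly B = char_poly (diag_mx sp).
    rewrite /char_poly.
    have -> : char_poly_mx B = map_mx polyC (invmx P) *m char_poly_mx (diag_mx sp)
        *m map_mx polyC P.
      rewrite /char_poly_mx mulmxBr mulmxBl -!map_mxM -BE /=; congr (_ - _).
      rewrite mul_mx_scalar -scalemxAl -map_mxM mulVmx // map_mx1.
      by rewrite scale_scalar_mx mulr1.
    rewrite !det_mulmx mulrAC -det_mulmx -map_mxM mulVmx //.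
    by rewrite map_mx1 det1 mul1r.
  rewrite /char_poly; have -> : char_poly_mx (diag_mx sp) = diag_mx (\row_i ('X - (sp 0 i)%:P)).
    apply/matrixP => i j; rewrite !mxE; case: eqP => [->|]; last by rewrite !mulr0n subr0.
    by rewrite !mulr1n.
  rewrite det_diag; apply: eq_bigr => i _.
  by rewrite mxE map_polyXsubC dE.
move=> l; apply: f_inj; rewrite [RHS]rmorph_sum.
transitivity (\tr (map_mx f (A ^+ l))); first by rewrite trace_map_mx.
have -> : map_mx f (A ^+ l) = invmx P *m diag_mx (\row_i sp 0 i ^+ l) *m P.
  elim: l => [|l IH].
    rewrite expr0 map_mx1; have -> : diag_mx (\row_i sp 0 i ^+ 0) = 1%:M.
      by apply/matrixP => i j; rewrite !mxE expr0.
    by rewrite mulmx1 mulVmx.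
  rewrite exprS map_mxM -/B IH BE !mulmxA.
  rewrite (mulmxK Pu) -!mulmxA; congr (_ *m _); rewrite !mulmxA; congr (_ *m _).
  rewrite mulmx_diag; congr diag_mx.
  by apply/rowP => i; rewrite !mxE exprS.
rewrite mxtrace_mulC mulmxA mulmxV // mul1mx mxtrace_diag.
by apply: eq_bigr => i _; rewrite mxE dE rmorphXn.
Qed.
End SymmetricSpectrum.

Lemma uniq_simple_roots (R : idomainType) (s : seq R) :
  (forall x, x \in s -> (\prod_(y <- s) ('X - y%:P))^`().[x] != 0) -> uniq s.
Proof.
elim: s => [//|y s IH] /= H; apply/andP; split.
  have := H y (mem_head _ _).
  rewrite big_cons derivM !hornerD !hornerM !hornerXsubC derivXsubC hornerC.
  rewrite subrr mul0r addr0 mul1r; apply: contraNN.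
  by rewrite -root_prod_XsubC.
apply: IH => x xs; have := H x (mem_behead (s := y :: s) xs).
rewrite big_cons derivM !hornerD !hornerM !hornerXsubC derivXsubC hornerC mul1r.
have /rootP -> : root (\prod_(y0 <- s) ('X - y0%:P)) x by rewrite root_prod_XsubC.
by rewrite add0r mulf_eq0 => /norP[].
Qed.

(** * Truncated Jacobi matrices and the zeros of the polynomials *)

Section JacobiMatrix.
Variable R : realType.
Variables a b : nat -> R.
Hypothesis ha : forall n, 0 < a n.

Definition jacobi_mx n : 'M[R]_n :=
  \matrix_(i, j) (if i == j then b i else if j == i.+1 :> nat then a i
                  else if i == j.+1 :> nat then a j else 0).

(* The truncation to the first [n] sites is the direct summand obtained by
   cutting the bond [a (n - 1)]. *)
Definition cut_bond n k : R := if (k.+1 < n)%N then a k else 0.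

Lemma tr_jacobi_mx n : (jacobi_mx n)^T = jacobi_mx n.
Proof.
apply/matrixP => i j; rewrite !mxE eq_sym -!val_eqE /=.
case: eqP => [/val_inj -> //|_].
by case: eqP => [ji|_]; case: eqP => // ij; exfalso; move: ij ji => /=; lia.
Qed.

(** The entries of [v] lie in an arbitrary module because both real vectors (matrix powers) and
    polynomial vectors (the eigenvector equation) occur. *)
Lemma jacobi_mx_apply (V : lmodType R) n (v : nat -> V) (i : 'I_n) :
  \sum_j jacobi_mx n i j *: v j =
  b i *: v i + cut_bond n i *: v i.+1
    + (if val i is m.+1 then a m *: v m else 0).
Proof.
have delta (c : R) k : \sum_(j < n) (c * (j == k :> nat)%:R) *: v j =
    if (k < n)%N then c *: v k else 0.
  case: ltnP => kn; last first.
    apply: big1 => j _; rewrite (_ : (_ == _) = false) ?mulr0 ?scale0r //.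
    by apply/negbTE; rewrite neq_ltn (leq_trans (ltn_ord j)).
  rewrite (bigD1 (Ordinal kn)) //= eqxx mulr1 big1 ?addr0 // => j.
  by rewrite -val_eqE /= => /negbTE ->; rewrite mulr0 scale0r.
transitivity (\sum_(j < n) ((b i * (j == i :> nat)%:R) *: v j +
   (cut_bond n i * (j == i.+1 :> nat)%:R) *: v j +
   (if val i is m.+1 then (a m * (j == m :> nat)%:R) *: v j else 0))).
  apply: eq_bigr => j _; rewrite !mxE -val_eqE /cut_bond /=.
  case: (ltngtP i j) => ij.
  - rewrite mulr0 scale0r add0r.
    have -> : (match (i : nat) with 0%N => 0 | m.+1 => (a m * (j == m :> nat)%:R) *: v j end) = 0.
      case: (i : nat) ij => [//|m] ij.
      by rewrite (_ : (_ == _) = false) ?mulr0 ?scale0r //; lia.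
    rewrite addr0; case: eqP => ji.
      by rewrite ifT ?mulr1 // -ji.
    by rewrite mulr0 ifF ?scale0r //; lia.
  - rewrite mulr0 scale0r add0r (_ : (_ == i.+1) = false); last by lia.
    rewrite mulr0 scale0r add0r.
    case: (i : nat) ij => [//|m] ij.
    by rewrite eqSS eq_sym; case: eqP => [->|]; rewrite ?mulr1 ?mulr0 ?scale0r.
  - have E : (i : nat) = j by [].
    rewrite -?E mulr1 (_ : (_ == i.+1) = false); last by lia.
    rewrite mulr0 scale0r addr0; case: (i : nat) => [|m]; rewrite ?addr0 //.
    by rewrite (_ : (_ == m) = false) ?mulr0 ?scale0r ?addr0 //; lia.
rewrite !big_split /= !delta ltn_ord /cut_bond; congr (_ + _ + _).
  by case: ifP => [->|_] //; rewrite scale0r.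
case: i => -[|m] /= hm; first by rewrite big1.
by rewrite delta ifT // ltnW.
Qed.

Lemma jacobi_mx_exp n l (i j : 'I_n) :
  (jacobi_mx n ^+ l) i j = jacobi_col (cut_bond n) b l j i.
Proof.
elim: l i => [|l IH] i; first by rewrite expr0 mxE /jacobi_col /= -val_eqE.
rewrite exprS mxE jacobi_colS /jacobi_apply.
under eq_bigr do rewrite IH.
have := @jacobi_mx_apply R^o n (jacobi_col (cut_bond n) b l j) i => /= ->.
congr (_ + _); case: i => -[|m] //= hm.
by rewrite /cut_bond hm.
Qed.

(** The column [p_0, ..., p_{n-1}] is a formal eigenvector of the truncation for the eigenvalue
    ['X], up to a multiple of [p_n] in the last row. Multiplying by the adjugate and reading the row
    of [p_0 = 1] shows that [p_n] divides the characteristic polynomial, which has the same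
    degree. *)
Lemma char_poly_jacobi_mx n :
  jacobi_poly a b n = lead_coef (jacobi_poly a b n) *: char_poly (jacobi_mx n).
Proof.
suff div : jacobi_poly a b n %| char_poly (jacobi_mx n).
  have : jacobi_poly a b n %= char_poly (jacobi_mx n).
    by rewrite -dvdp_size_eqp // size_char_poly size_jacobi_poly.
  move=> /eqpP[[c d] /= /andP[c0 d0] E].
  have := congr1 lead_coef E; rewrite !lead_coefZ.
  rewrite (monicP (char_poly_monic _)) mulr1 => Ed.
  apply: (scalerI c0); rewrite E scalerA.
  by rewrite Ed.
case: n => [|n]; first by rewrite /jacobi_poly /= dvd1p.
pose q := \col_(i < n.+1) jacobi_poly a b i.
have E : char_poly_mx (jacobi_mx n.+1) *m q =
    \col_i (if i == ord_max then a n *: jacobi_poly a b n.+1 else 0).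
  apply/colP => i; rewrite mulmxBl mul_scalar_mx !mxE.
  under eq_bigr do rewrite ![_ _ 0]mxE [map_mx _ _ _ _]mxE mul_polyC.
  rewrite jacobi_mx_apply jacobi_poly_rec // /cut_bond ltnS.
  rewrite -val_eqE /=; case: (ltngtP i n) => hi.
  - by rewrite [b i *: _ + _]addrC subrr.
  - by have := leq_ltn_trans hi (ltn_ord i); rewrite ltnn.
  - by rewrite scale0r addr0 hi -[a n *: _ + _ + _]addrA; exact: addrK.
have := congr1 (mulmx (\adj (char_poly_mx (jacobi_mx n.+1)))) E.
rewrite mulmxA mul_adj_mx => /(congr1 (fun A : 'cV__ => A 0 0)).
rewrite mul_scalar_mx !mxE /jacobi_poly /= mulr1 => H.
rewrite /char_poly H; apply: (big_ind (fun r => jacobi_poly a b n.+1 %| r)) => [|x y|i _].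
- exact: dvdp0.
- exact: dvdp_add.
- rewrite [X in _ * X]mxE; case: eqP => _; last by rewrite mulr0 dvdp0.
apply: dvdp_mull; rewrite dvdpZr ?gt_eqF //.
Qed.

Variable M : R.
Hypothesis hM : forall n, `|a n| <= M /\ `|b n| <= M.

(** At a zero of [p_n] the values of [p_0, ..., p_{n-1}] form an eigenvector of the truncation; the
    row of its largest entry gives the bound, as in Gershgorin's theorem. *)
Lemma jacobi_poly_root_bound n x : root (jacobi_poly a b n) x -> `|x| <= 3 * M.
Proof.
move=> /rootP x0.
pose F (i : 'I_n.+1) := `|(jacobi_poly a b i).[x]|.
have [i _ Fi] := arg_maxP F (isT : xpredT (ord0 : 'I_n.+1)).
have Fi0 : 0 < F i.
  by apply: lt_le_trans (Fi ord0 isT); rewrite /F /jacobi_poly /= hornerE normr1.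
have lin : (i < n)%N.
  rewrite ltn_neqAle -ltnS ltn_ord andbT; apply/eqP => E.
  by move: Fi0; rewrite /F E x0 normr0 ltxx.
have bnd k : (k < n.+1)%N -> `|(jacobi_poly a b k).[x]| <= F i.
  by move=> hk; exact: (Fi (Ordinal hk)).
have M0 : 0 <= M by apply: le_trans (proj1 (hM 0%N)).
rewrite -(ler_pM2r Fi0) /F -normrM.
have := congr1 (horner^~ x) (jacobi_poly_rec b ha i).
rewrite !hornerD !hornerM hornerX (hornerZ _ (jacobi_poly a b i.+1)).
rewrite (hornerZ _ (jacobi_poly a b i)) => ->.
have K c y : `|c| <= M -> `|y| <= F i -> `|c * y| <= M * F i.
  by move=> hc hy; rewrite normrM ler_pM.
apply: le_trans (ler_normD _ _) _.
have := ler_normD (a i * (jacobi_poly a b i.+1).[x]) (b i * (jacobi_poly a b i).[x]).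
have := K _ _ (proj1 (hM i)) (bnd i.+1 lin).
have := K _ _ (proj2 (hM i)) (bnd i (ltn_ord i)).
have : `|(match (i : nat) with 0%N => 0 | m.+1 => a m *: jacobi_poly a b m end).[x]|
    <= M * F i.
  case: (i : nat) (ltn_ord i) => [|m] hm; first by rewrite horner0 normr0 mulr_ge0 // ltW.
  by rewrite hornerZ; apply: K (proj1 (hM m)) (bnd _ _); rewrite ltnW.
rewrite -/(F i); lra.
Qed.

(** The two diagonal entries at [i] can differ only if [l] steps from [i] reach the cut. This
    concerns at most [l] sites, and [jacobi_col_bound] applies to both entries. *)
Lemma trace_jacobi_mx_exp n l :
  `|\tr (jacobi_mx n ^+ l) - \sum_(i < n) jacobi_diag a b l i|
    <= 2 * (3 * M) ^+ l * l%:R.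
Proof.
have M0 : 0 <= M by apply: le_trans (proj1 (hM 0%N)).
have K0 : 0 <= 2 * (3 * M) ^+ l by rewrite mulr_ge0 // exprn_ge0 // mulr_ge0.
rewrite /mxtrace -sumrB; apply: le_trans (ler_norm_sum _ _ _) _.
apply: (@le_trans _ _ (\sum_(i < n) (if (i + l < n)%N then 0 else 2 * (3 * M) ^+ l))).
  apply: ler_sum => i _; rewrite jacobi_mx_exp /jacobi_diag.
  case: ltnP => il.
    rewrite (@jacobi_col_local _ (cut_bond n) b a b) ?subrr ?normr0 // => k hk.
    by rewrite /cut_bond ifT //; lia.
  apply: le_trans (ler_normB _ _) _.
  have hM' k : `|cut_bond n k| <= M /\ `|b k| <= M.
    rewrite /cut_bond; split; last exact: (proj2 (hM k)).
    by case: ifP => _; rewrite ?normr0 ?(proj1 (hM k)).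
  have := jacobi_col_bound l i i hM'.
  have := jacobi_col_bound l i i hM.
  lra.
rewrite -(big_mkord xpredT (fun i => if (i + l < n)%N then 0 else 2 * (3 * M) ^+ l)).
rewrite (big_cat_nat (n := (n - l)%N)) ?leq_subr //=.
rewrite big_nat big1 ?add0r; last by move=> i hi; rewrite ifT //; lia.
rewrite big_nat (eq_bigr (fun=> 2 * (3 * M) ^+ l)); last first.
  by move=> i hi; rewrite ifF //; lia.
rewrite -big_nat sumr_const_nat -[X in X <= _]mulr_natr; apply: ler_wpM2l => //.
rewrite ler_nat; lia.
Qed.

Lemma jacobi_poly_roots n : exists s : seq R,
  [/\ uniq s, size s = n,
      jacobi_poly a b n = lead_coef (jacobi_poly a b n) *: \prod_(x <- s) ('X - x%:P)
    & forall l, `|\sum_(x <- s) x ^+ l - \sum_(i < n) jacobi_diag a b l i|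
        <= 2 * (3 * M) ^+ l * l%:R].
Proof.
have [d [dE dtr]] := symmetric_spectrum (tr_jacobi_mx n).
have pE : jacobi_poly a b n = lead_coef (jacobi_poly a b n)
    *: \prod_(x <- codom d) ('X - x%:P).
  by rewrite big_image /= -dE -char_poly_jacobi_mx.
exists (codom d); split => //; last 2 first.
- by rewrite size_codom card_ord.
- by move=> l; rewrite big_image /= -dtr; exact: trace_jacobi_mx_exp.
have lc0 : lead_coef (jacobi_poly a b n) != 0.
  by rewrite gt_eqF // lead_jacobi_poly_gt0.
apply: uniq_simple_roots => x xs.
have rx : root (jacobi_poly a b n) x by rewrite pE rootZ // root_prod_XsubC.
have := jacobi_poly_simple_root ha rx.
by rewrite {1}pE derivZ hornerZ mulf_eq0 => /norP[].
Qed.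

End JacobiMatrix.

(** * Polynomials with simple real zeros *)

Section SplitPolynomials.
Variable R : rcfType.
Implicit Types (p q : {poly R}) (s : seq R).

Lemma mem_rootsR p x : p != 0 -> (x \in rootsR p) = root p x.
Proof. by move=> /roots_on_rootsR/(_ x); rewrite in_itv /= => ->. Qed.

Lemma uniq_rootsR p : uniq (rootsR p).
Proof. exact: uniq_roots. Qed.

(** As [rootsR] lists every real zero once, this says for a nonzero [p] that all zeros are real and
    simple. *)
Definition real_rooted p := p = lead_coef p *: \prod_(x <- rootsR p) ('X - x%:P).

Lemma perm_rootsR p s c : c != 0 -> uniq s -> p = c *: \prod_(x <- s) ('X - x%:P) ->
  perm_eq (rootsR p) s.
Proof.
move=> c0 us pE; apply: uniq_perm => //; first exact: uniq_rootsR.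
have p0 : p != 0 by rewrite pE scaler_eq0 negb_or c0 /= prodf_seq_neq0;
  apply/allP => x _; rewrite polyXsubC_eq0.
by move=> x; rewrite mem_rootsR // pE rootZ // root_prod_XsubC.
Qed.

Lemma real_rootedP p s c : c != 0 -> uniq s -> p = c *: \prod_(x <- s) ('X - x%:P) ->
  real_rooted p.
Proof.
move=> c0 us pE; rewrite /real_rooted (perm_big _ (perm_rootsR c0 us pE)) /=.
by rewrite [in lead_coef _]pE lead_coefZ (monicP (monic_prod_XsubC _ _ _)) mulr1.
Qed.

Lemma size_rootsR p : p != 0 -> real_rooted p -> size (rootsR p) = (size p).-1.
Proof.
by move=> p0 pr; rewrite [in RHS]pr size_scale ?lead_coef_eq0 // size_prod_XsubC.
Qed.

Lemma real_rooted_dvd p q : q != 0 -> real_rooted q -> p %| q -> real_rooted p.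
Proof.
move=> q0 qr; rewrite {1}qr dvdpZr ?lead_coef_eq0 // => /dvdp_prod_XsubC[m].
move=> /eqpP[[c d] /= /andP[c0 d0] E].
apply: (@real_rootedP _ (mask m (rootsR q)) (c^-1 * d)).
- by rewrite mulf_neq0 // invr_eq0.
- exact: (mask_uniq (uniq_rootsR q) m).
- by rewrite -scalerA -E scalerA mulVf // scale1r.
Qed.

(** Both factors inherit real-rootedness, so the two lists yield the same product of linear factors
    and unique factorization matches them. *)
Lemma perm_rootsRM p q : p * q != 0 -> real_rooted (p * q) ->
  perm_eq (rootsR (p * q)) (rootsR p ++ rootsR q).
Proof.
move=> pq0 pqr; move: (pq0); rewrite mulf_eq0 negb_or => /andP[p0 q0].
have pr := real_rooted_dvd pq0 pqr (dvdp_mulr q (dvdpp p)).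
have qr := real_rooted_dvd pq0 pqr (dvdp_mull p (dvdpp q)).
apply: prod_XsubC_eq; rewrite big_cat /=.
have lc0 : lead_coef (p * q) != 0 by rewrite lead_coef_eq0.
apply: (scalerI lc0); rewrite -pqr lead_coefM -scalerA scalerAr -qr.
by rewrite scalerAl -pr.
Qed.

Lemma sum_rootsR_prod (V : nmodType) (F : R -> V) I (r : seq I) (f : I -> {poly R}) :
  \prod_(i <- r) f i != 0 -> real_rooted (\prod_(i <- r) f i) ->
  \sum_(x <- rootsR (\prod_(i <- r) f i)) F x =
  \sum_(i <- r) \sum_(x <- rootsR (f i)) F x.
Proof.
elim: r => [|i r IH]; first by rewrite !big_nil rootsRC big_nil.
rewrite !big_cons => h0 hr; rewrite (perm_big _ (perm_rootsRM h0 hr)) big_cat /=.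
congr (_ + _); apply: IH.
  by move: h0; rewrite mulf_eq0 negb_or => /andP[].
exact: real_rooted_dvd h0 hr (dvdp_mull _ (dvdpp _)).
Qed.

End SplitPolynomials.

Section JacobiRoots.
Variable R : realType.
Variables (a b : nat -> R) (M : R).
Hypothesis ha : forall n, 0 < a n.
Hypothesis hM : forall n, `|a n| <= M /\ `|b n| <= M.

Lemma jacobi_poly_real_rooted n : real_rooted (jacobi_poly a b n).
Proof.
have [s [us _ sE _]] := jacobi_poly_roots ha hM n.
by apply: real_rootedP us sE; rewrite gt_eqF // lead_jacobi_poly_gt0.
Qed.

Lemma jacobi_poly_power_sum n l :
  `|\sum_(x <- rootsR (jacobi_poly a b n)) x ^+ l - \sum_(i < n) jacobi_diag a b l i|
  <= 2 * (3 * M) ^+ l * l%:R.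
Proof.
have [s [us _ sE sl]] := jacobi_poly_roots ha hM n.
have lc0 : lead_coef (jacobi_poly a b n) != 0.
  by rewrite gt_eqF // lead_jacobi_poly_gt0.
by rewrite (perm_big _ (perm_rootsR lc0 us sE)) /=; exact: sl.
Qed.

End JacobiRoots.

(** * Chebyshev polynomials dilated to [-2, 2] and their zeros *)

Section DilatedChebyshev.
Variable R : realType.

(* [dilated_cheby n] evaluated at 2 cos t is sin (n t) / sin t. *)
Fixpoint dilated_cheby_pair n : {poly R} * {poly R} :=
  if n is m.+1 then
    ((dilated_cheby_pair m).2,
     'X * (dilated_cheby_pair m).2 - (dilated_cheby_pair m).1)
  else (0, 1).

Definition dilated_cheby n := (dilated_cheby_pair n).1.

Lemma dilated_cheby_rec n :
  dilated_cheby n.+2 = 'X * dilated_cheby n.+1 - dilated_cheby n.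
Proof. by []. Qed.

Lemma size_dilated_cheby n : size (dilated_cheby n) = n.
Proof.
suff [] : size (dilated_cheby n) = n /\ size (dilated_cheby n.+1) = n.+1 by [].
elim: n => [|n [IH1 IH2]]; first by rewrite size_poly0 size_poly1.
split => //; rewrite dilated_cheby_rec.
have sX : size ('X * dilated_cheby n.+1) = n.+2.
  by rewrite mulrC size_mulX -?size_poly_eq0 IH2.
by rewrite size_polyDl sX // size_polyN IH1; lia.
Qed.

Lemma dilated_cheby_cos n (t : R) :
  (dilated_cheby n).[2 * cos t] * sin t = sin (n%:R * t).
Proof.
suff [] : (dilated_cheby n).[2 * cos t] * sin t = sin (n%:R * t) /\
  (dilated_cheby n.+1).[2 * cos t] * sin t = sin (n.+1%:R * t) by [].
elim: n => [|n [IH1 IH2]]; first by rewrite /dilated_cheby /= !hornerE ?mulr0n ?mul0r sin0 ?mul1r.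
split => //; rewrite dilated_cheby_rec !hornerE mulrBl IH1 -mulrA IH2.
have -> : n.+2%:R * t = n.+1%:R * t + t by rewrite -(natr1 n.+1); ring.
have -> : n%:R * t = n.+1%:R * t - t by rewrite -(natr1 n); ring.
by rewrite sinB sinD; ring.
Qed.

(** For [0 < j < N] these are the zeros of [dilated_cheby N]; a larger [j] means a lower height. *)
Definition level N j : R := 2 * cos (j%:R * pi / N%:R).

Lemma level_angle N j : (0 < j < N)%N -> (0 : R) < j%:R * @pi R / N%:R < @pi R.
Proof.
move=> /andP[j0 jN]; have N0 : (0 : R) < N%:R by rewrite ltr0n; lia.
have p0 := pi_gt0 R.
apply/andP; split; first by rewrite divr_gt0 // mulr_gt0 // ltr0n.
by rewrite ltr_pdivrMr // mulrC ltr_pM2l // ltr_nat.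
Qed.

Lemma level_inj N i j : (0 < i < N)%N -> (0 < j < N)%N -> level N i = level N j -> i = j.
Proof.
move=> hi hj /(mulfI _) E; have {}E := E (lt0r_neq0 (ltr0n _ 2)).
have := level_angle hi; have := level_angle hj => /andP[j1 j2] /andP[i1 i2].
have /mulIf : (N%:R : R)^-1 != 0 by rewrite invr_eq0 pnatr_eq0; lia.
have := cos_inj _ _ E; rewrite !in_itv /= !ltW // => /(_ isT isT) h /(_ _ _ h).
by move=> /(mulIf (lt0r_neq0 (pi_gt0 R))) /eqP; rewrite eqr_nat => /eqP.
Qed.

Lemma dilated_cheby_prod N : (0 < N)%N ->
  dilated_cheby N = lead_coef (dilated_cheby N) *:
    \prod_(1 <= j < N) ('X - (level N j)%:P).
Proof.
move=> N0.
rewrite -(big_map (level N) xpredT (fun x => 'X - x%:P)).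
apply: all_roots_prod_XsubC.
- by rewrite size_dilated_cheby size_map size_iota; lia.
- apply/allP => _ /mapP[j + ->]; rewrite mem_index_iota => jN; apply/rootP.
  have /andP[h1 h2] := level_angle jN.
  have s0 : sin (j%:R * pi / N%:R) != 0 :> R by rewrite gt_eqF // sin_gt0_pi // h1.
  apply: (mulIf s0); rewrite dilated_cheby_cos mul0r mulrC mulfVK ?pnatr_eq0; last by lia.
  elim: (j) => [|k IH]; first by rewrite mul0r sin0.
  by rewrite -natr1 mulrDl mul1r sinDpi IH oppr0.
- rewrite uniq_rootsE map_inj_in_uniq ?iota_uniq // => i j.
  by rewrite !mem_index_iota => hi hj; exact: level_inj.
Qed.

End DilatedChebyshev.

(** * Monodromy of a periodic Jacobi matrix *)

Lemma det_mx22 (R : comPzRingType) (A : 'M[R]_2) :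
  \det A = A 0 0 * A 1 1 - A 0 1 * A 1 0.
Proof.
rewrite (expand_det_row _ 0) !big_ord_recl big_ord0 addr0 /cofactor.
rewrite !det_mx11 !mxE /= !addn0 expr0 mul1r expr1 mulN1r mulrN.
by congr (A _ _ * A _ _ - A _ _ * A _ _); apply/val_inj.
Qed.

Lemma sqr_mx22 (R : comPzRingType) (A : 'M[R]_2) :
  A *m A = \tr A *: A - (\det A)%:M.
Proof.
have two (i : 'I_2) : i = 0 \/ i = 1.
  by case: i => -[|[|//]] hi; [left|right]; apply/val_inj.
apply/matrixP => i j; rewrite det_mx22 /mxtrace !mxE !big_ord_recl !big_ord0 !addr0.
have -> : lift ord0 ord0 = 1 :> 'I_2 by apply/val_inj.
have -> : (ord0 : 'I_2) = 0 by apply/val_inj.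
by case: (two i) => ->; case: (two j) => -> /=; rewrite ?mulr1n ?mulr0n; ring.
Qed.

Section PeriodicJacobi.
Variable R : realType.

(** The half-line begins at site 1, so that the transfer matrices over its first period multiply to
    exactly the product inside [discriminant]. *)
Definition right_half (a : int -> R) (k : nat) : R := a k.+1%:Z.

Variables (p : nat) (a0 b0 : int -> R).
Hypothesis hp : (0 < p)%N.
Hypothesis hJ : periodic_jacobi p a0 b0.

Let al := right_half a0.
Let be := right_half b0.

Lemma right_half_gt0 n : 0 < al n.
Proof. exact: (proj1 hJ). Qed.

Lemma right_half_periodic n k : al (n + k * p) = al n /\ be (n + k * p) = be n.
Proof.
elim: k => [|k [IHa IHb]]; first by rewrite mul0n addn0.
have E : ((n + k.+1 * p).+1)%:Z = (n + k * p).+1%:Z + p%:Z by lia.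
rewrite -IHa -IHb /al /be /right_half E.
exact: (proj2 hJ).
Qed.

Lemma right_half_bounded : exists M : R, forall n, `|al n| <= M /\ `|be n| <= M.
Proof.
exists (\sum_(i < p) (`|al i| + `|be i|)) => n.
have lt : (n %% p < p)%N by rewrite ltn_mod.
have [Ea Eb] := right_half_periodic (n %% p) (n %/ p).
rewrite {1 2}(divn_eq n p) addnC Ea Eb (bigD1 (Ordinal lt)) //=.
have S0 : 0 <= \sum_(i < p | i != Ordinal lt) (`|al i| + `|be i|).
  by apply: sumr_ge0 => i _; rewrite addr_ge0.
have := normr_ge0 (al (n %% p)); have := normr_ge0 (be (n %% p)).
by split; lra.
Qed.

Let w n : 'cV[{poly R}]_2 :=
  \col_i (if i == 0 then (jacobi_pair al be n).1 else (jacobi_pair al be n).2).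

Let step n : w n.+1 = transfer a0 b0 n.+1%:Z *m w n.
Proof.
have an : al n != 0 by rewrite gt_eqF // right_half_gt0.
apply/colP => i; rewrite !mxE !big_ord_recl big_ord0 addr0 !mxE /=.
case: i => -[|[|//]] /= hi.
  by rewrite -/(al n) -/(be n) -mul_polyC; ring.
rewrite -/(al n) mulr0 mul0r addr0 expr2 polyCM mulrA -polyCM mulVf //.
by rewrite mul1r mul_polyC.
Qed.

Let mono m := \prod_(i < m) transfer a0 b0 (m - i)%:Z.

Let monoS m : mono m.+1 = transfer a0 b0 m.+1%:Z *m mono m.
Proof. by rewrite /mono big_ord_recl subn0. Qed.

Let w_mono m k : w (m + k * p) = mono m *m w (k * p).
Proof.
elim: m => [|m IH]; first by rewrite /mono big_ord0 mul1mx.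
rewrite addSn step IH monoS mulmxA; congr (_ *m _ *m _).
have [] := right_half_periodic m k; rewrite /al /be /right_half => Ea Eb.
by rewrite /transfer Ea Eb.
Qed.

Let det_mono m : \det (mono m) = 1.
Proof.
elim: m => [|m IH]; first by rewrite /mono big_ord0 det1.
rewrite monoS det_mulmx IH mulr1 det_mx22 !mxE /= !mulr0 sub0r.
have an : a0 m.+1%:Z != 0 by rewrite gt_eqF // (proj1 hJ).
have h : (a0 m.+1%:Z)^-1%:P * (a0 m.+1%:Z)%:P = 1 :> {poly R}.
  by rewrite -polyCM mulVf.
rewrite expr2 polyCM; transitivity
  (((a0 m.+1%:Z)^-1%:P * (a0 m.+1%:Z)%:P) ^+ 2 : {poly R}); first by ring.
by rewrite h expr1n.
Qed.

Let Delta := discriminant p a0 b0.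

(** Cayley-Hamilton for the monodromy matrix, which has determinant 1 and, by definition, trace
    [Delta]. *)
Lemma jacobi_pair2_rec k : (jacobi_pair al be (k.+2 * p)).2 =
  Delta * (jacobi_pair al be (k.+1 * p)).2 - (jacobi_pair al be (k * p)).2.
Proof.
have E : w (k.+2 * p) = \tr (mono p) *: w (k.+1 * p) - w (k * p).
  rewrite mulSn w_mono mulSn w_mono mulmxA sqr_mx22 det_mono.
  by rewrite mulmxBl mul1mx -scalemxAl.
by have := congr1 (fun A : 'cV_2 => A 1 0) E; rewrite !mxE.
Qed.

(** The second entry is the useful one: it is 0 at index 0, like [dilated_cheby], so the value at
    [p] factors out of the whole recursion. *)
Lemma jacobi_pair2_cheby k : (jacobi_pair al be (k * p)).2 =
  (dilated_cheby R k \Po Delta) * (jacobi_pair al be p).2.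
Proof.
suff [] : (jacobi_pair al be (k * p)).2 =
    (dilated_cheby R k \Po Delta) * (jacobi_pair al be p).2 /\
  (jacobi_pair al be (k.+1 * p)).2 =
    (dilated_cheby R k.+1 \Po Delta) * (jacobi_pair al be p).2 by [].
elim: k => [|k [IH1 IH2]]; first by rewrite mul1n comp_poly0 comp_polyC !mul0r mul1r.
split => //; rewrite jacobi_pair2_rec IH1 IH2 dilated_cheby_rec.
by rewrite comp_polyB comp_polyM comp_polyX; ring.
Qed.

Lemma jacobi_poly_period N : (0 < N)%N ->
  exists2 c, c != 0 & jacobi_poly al be (N * p).-1 =
   jacobi_poly al be p.-1 * (c *: \prod_(1 <= j < N) (Delta - (level R N j)%:P)).
Proof.
move=> N0; have E := jacobi_pair2_cheby N.
have Np : (0 < N * p)%N by rewrite muln_gt0 N0.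
have snd n : (0 < n)%N -> (jacobi_pair al be n).2 = al n.-1 *: jacobi_poly al be n.-1.
  by case: n.
move: E; rewrite !snd //.
have [A Ap] : exists2 A, A != 0 & al (N * p).-1 = A.
  by exists (al (N * p).-1); rewrite // gt_eqF // right_half_gt0.
have [B Bp] : exists2 A, A != 0 & al p.-1 = A.
  by exists (al p.-1); rewrite // gt_eqF // right_half_gt0.
move=> -> ->; rewrite dilated_cheby_prod // comp_polyZ => E.
have lc : lead_coef (dilated_cheby R N) != 0.
  by rewrite lead_coef_eq0 -size_poly_eq0 size_dilated_cheby; lia.
exists (A^-1 * B * lead_coef (dilated_cheby R N)).
  by rewrite !mulf_neq0 ?invr_eq0.
apply: (scalerI Ap); rewrite E.
rewrite rmorph_prod /= (eq_bigr (fun j => Delta - (level R N j)%:P)); last first.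
  by move=> j _; rewrite comp_polyB comp_polyX comp_polyC.
rewrite -scalerAl -!scalerAr !scalerA [jacobi_poly _ _ p.-1 * _]mulrC.
by congr (_ *: _); field.
Qed.

End PeriodicJacobi.

(** * Solutions of [Delta = 2 cos (j pi / N)] *)

Section PeriodicLevels.
Variable R : realType.
Variables (p : nat) (a0 b0 : int -> R).
Hypothesis hp : (0 < p)%N.
Hypothesis hJ : periodic_jacobi p a0 b0.
Let al := right_half a0.
Let be := right_half b0.
Let al_gt0 n : 0 < al n. Proof. exact: right_half_gt0 hJ n. Qed.
Let Delta := discriminant p a0 b0.

(** The degree is read off from [jacobi_poly_period] with two periods: [2 p - 1] on the left, and on
    the right [p - 1] plus the degree of the single factor [Delta - level R 2 1]. *)
Lemma size_discriminant : size Delta = p.+1.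
Proof.
have [c c0 E] := jacobi_poly_period hp hJ (isT : (0 < 2)%N).
have := congr1 (fun q : {poly R} => size q) E.
rewrite /index_iota /= big_seq1 -scalerAr size_scale // size_jacobi_poly //.
have [->|d0] := eqVneq (Delta - (level R 2 1)%:P) 0.
  by rewrite mulr0 size_poly0; have := hp; lia.
rewrite size_mul ?jacobi_poly_neq0 // size_jacobi_poly // -/Delta => sE.
have sD : size (Delta - (level R 2 1)%:P) = p.+1.
  by move: sE; set s := size _; have := hp; lia.
have -> : Delta = (Delta - (level R 2 1)%:P) + (level R 2 1)%:P by rewrite subrK.
rewrite size_polyDl sD // (leq_ltn_trans (size_polyC_leq1 _)) //.
Qed.

Lemma discriminant_subC_neq0 y : Delta - y%:P != 0.
Proof.
rewrite -size_poly_eq0 size_polyDl size_discriminant // size_polyN.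
by rewrite (leq_ltn_trans (size_polyC_leq1 _)).
Qed.

Lemma size_discriminant_subC y : size (Delta - y%:P) = p.+1.
Proof.
by rewrite size_polyDl size_discriminant // size_polyN (leq_ltn_trans (size_polyC_leq1 _)).
Qed.

(** Through this divisibility the zeros of [jacobi_poly], which are real, simple and bounded, pass
    these properties on to the points at height [level R N j]. *)
Lemma level_dvd N j : (0 < j < N)%N ->
  exists2 q, q != 0 & jacobi_poly al be (N * p).-1 = (Delta - (level R N j)%:P) * q.
Proof.
move=> jN; have N0 : (0 < N)%N by lia.
have [c c0 E] := jacobi_poly_period hp hJ N0.
have jin : j \in index_iota 1 N by rewrite mem_index_iota.
rewrite E (bigD1_seq j) ?iota_uniq //= -scalerAr mulrCA scalerAr.
eexists; last reflexivity.
have : jacobi_poly al be (N * p).-1 != 0 by exact: jacobi_poly_neq0.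
rewrite E (bigD1_seq j) ?iota_uniq //= -scalerAr mulrCA scalerAr.
by rewrite mulf_eq0 negb_or => /andP[].
Qed.

Variable M : R.
Hypothesis hM : forall n, `|al n| <= M /\ `|be n| <= M.

Lemma size_level_roots N j : (0 < j < N)%N ->
  size (rootsR (Delta - (level R N j)%:P)) = p.
Proof.
move=> /level_dvd[q q0 E]; rewrite size_rootsR ?discriminant_subC_neq0 //.
  by rewrite size_discriminant_subC.
apply: (@real_rooted_dvd _ _ (jacobi_poly al be (N * p).-1)).
- exact: jacobi_poly_neq0.
- exact: jacobi_poly_real_rooted hM _.
- by rewrite E dvdp_mulr.
Qed.

Lemma level_root_bound N j x : (0 < j < N)%N ->
  Delta.[x] = level R N j -> `|x| <= 3 * M.
Proof.
move=> /level_dvd[q q0 E] Dx.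
apply: (jacobi_poly_root_bound (n := (N * p).-1) al_gt0 hM).
by rewrite E rootM rootE !hornerE Dx subrr eqxx.
Qed.

Lemma level_root_simple N j x : (0 < j < N)%N ->
  Delta.[x] = level R N j -> Delta^`().[x] != 0.
Proof.
move=> /level_dvd[q q0 E] Dx.
have : root (jacobi_poly al be (N * p).-1) x.
  by rewrite E rootM rootE !hornerE Dx subrr eqxx.
move=> /(jacobi_poly_simple_root al_gt0).
rewrite E derivM derivB derivC subr0 !hornerE Dx subrr mul0r addr0.
by rewrite mulf_eq0 => /norP[].
Qed.

Lemma periodic_jacobi_diag l i k : (l <= i)%N ->
  jacobi_diag al be l (i + k * p) = jacobi_diag al be l i.
Proof.
move=> li; rewrite /jacobi_diag jacobi_col_shift //.
congr (jacobi_col _ _ _ _ _); apply/funext => n.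
  exact: (proj1 (right_half_periodic hp hJ n k)).
exact: (proj2 (right_half_periodic hp hJ n k)).
Qed.

(** Up to a bounded error the power sum over the zeros of [p_{Np-1}] is a partial trace, and all
    zeros but those of [p_{p-1}] are level points. The offset [L] selects a period away from the
    boundary, where the diagonal entries are periodic. *)
Lemma level_power_sum l L : (l <= L)%N -> exists K : R, forall N, (0 < N)%N ->
  `|\sum_(1 <= j < N) \sum_(x <- rootsR (Delta - (level R N j)%:P)) x ^+ l
     - N%:R * \sum_(i < p) jacobi_diag al be l (L + i)| <= K.
Proof.
move=> lL; have M0 : 0 <= M by apply: le_trans (proj1 (hM 0%N)).
pose B := (3 * M) ^+ l.
have B0 : 0 <= B by rewrite exprn_ge0 // mulr_ge0.
pose K1 := `|\sum_(x <- rootsR (jacobi_poly al be p.-1)) x ^+ l|.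
(* In order: the zeros of [p_{p-1}], the truncation error of the trace, the first [L] diagonal
   entries, and the [L + 1] entries of index at least [N p - 1] and below [L + N p]. *)
exists (K1 + 2 * B * l%:R + B *+ L + B *+ L.+1) => N N0.
have [c c0 E] := jacobi_poly_period hp hJ N0.
have Np : (0 < N * p)%N by rewrite muln_gt0 N0.
have n0 := jacobi_poly_neq0 (a := al) be al_gt0 (N * p).-1.
have rr := jacobi_poly_real_rooted al_gt0 hM (N * p).-1.
set S := \sum_(1 <= j < N) _; set T := \sum_(i < p) _.
have rootsE : \sum_(x <- rootsR (jacobi_poly al be (N * p).-1)) x ^+ l =
   \sum_(x <- rootsR (jacobi_poly al be p.-1)) x ^+ l + S.
  move: n0 rr; rewrite E => n0 rr.
  rewrite (perm_big _ (perm_rootsRM n0 rr)) big_cat /=; congr (_ + _).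
  set P := \prod_(1 <= j < N) _ in n0 rr *.
  have P0 : P != 0.
    by move: n0; rewrite mulf_eq0 scaler_eq0 !negb_or => /andP[_ /andP[]].
  have Pr : real_rooted P.
    apply: real_rooted_dvd n0 rr _.
    by rewrite dvdp_mull // dvdpZr.
  have -> : S = _ := esym (sum_rootsR_prod (fun x => x ^+ l) P0 Pr).
  apply: perm_big; apply: uniq_perm.
  - exact: uniq_rootsR.
  - exact: uniq_rootsR.
  - by move=> x; rewrite !mem_rootsR ?rootZ // scaler_eq0 negb_or c0.
have bd i : `|jacobi_diag al be l i| <= B by exact: jacobi_col_bound.
have bds I (r : seq I) (f : I -> nat) :
    `|\sum_(i <- r) jacobi_diag al be l (f i)| <= B *+ size r.
  apply: le_trans (ler_norm_sum _ _ _) _.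
  by rewrite -sum1_size -sumrMnr; apply: ler_sum => i _; rewrite mulr1n.
have diagE : \sum_(i < L + N * p) jacobi_diag al be l i =
    \sum_(0 <= i < L) jacobi_diag al be l i + N%:R * T.
  rewrite -(big_mkord xpredT (jacobi_diag al be l)) (big_cat_nat (n := L)) ?leq_addr //=.
  congr (_ + _); rewrite -{1}[L]add0n big_addn addKn.
  elim: (N) => [|k IH]; first by rewrite mul0n big_geq // mul0r.
  rewrite mulSn (big_cat_nat (n := p)) ?leq_addr //= -natr1 mulrDl mul1r addrC.
  rewrite -IH -{1}[p]add0n big_addn addKn; congr (_ + _).
    apply: eq_bigr => i _.
    rewrite -(@periodic_jacobi_diag l (i + L) 1) ?(leq_trans lL) ?leq_addl //.
    by congr jacobi_diag; lia.
  by rewrite big_mkord; apply: eq_bigr => i _; rewrite addnC.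
have splitE : \sum_(i < L + N * p) jacobi_diag al be l i =
    \sum_(i < (N * p).-1) jacobi_diag al be l i +
    \sum_((N * p).-1 <= i < L + N * p) jacobi_diag al be l i.
  by rewrite -!(big_mkord xpredT (jacobi_diag al be l)) -big_cat_nat //=; lia.
have := jacobi_poly_power_sum al_gt0 hM (N * p).-1 l; rewrite rootsE -/B.
have := bds _ (index_iota 0 L) id; rewrite size_iota subn0.
have := bds _ (index_iota (N * p).-1 (L + N * p)) id.
rewrite size_iota (_ : (L + N * p - (N * p).-1)%N = L.+1); last by lia.
have := lexx K1; rewrite {1}/K1.
move: diagE splitE.
set x1 := \sum_(i < L + N * p) _; set x2 := \sum_(0 <= i < L) _.
set x3 := \sum_(i < (N * p).-1) _; set x4 := \sum_((N * p).-1 <= i < _) _.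
set x5 := \sum_(x <- _) _.
move=> e1 e2; rewrite !ler_norml => /andP[h1 h2] /andP[h3 h4] /andP[h5 h6] /andP[h7 h8].
by apply/andP; split; lra.
Qed.

End PeriodicLevels.

(** * Order of the levels and band structure *)

Section LevelOrder.
Variable R : realType.

Lemma ltr_level N i j : (0 < i < N)%N -> (0 < j < N)%N ->
  (level R N i < level R N j) = (j < i)%N.
Proof.
move=> hi hj; rewrite /level ltr_pM2l //.
have /andP[i1 i2] := level_angle R hi; have /andP[j1 j2] := level_angle R hj.
rewrite ltr_cos ?in_itv /= ?ltW // ltr_pM2r ?invr_gt0 ?ltr0n; last by lia.
by rewrite ltr_pM2r ?pi_gt0 // ltr_nat.
Qed.

Lemma ler_level N i j : (0 < i < N)%N -> (0 < j < N)%N ->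
  (level R N i <= level R N j) = (j <= i)%N.
Proof. by move=> hi hj; rewrite leNgt ltr_level // -leqNgt. Qed.

Lemma level_bound N j : (0 < j < N)%N -> `|level R N j| < 2.
Proof.
move=> hj; have /andP[j1 j2] := level_angle R hj.
rewrite /level normrM ger0_norm // -{2}[2]mulr1 ltr_pM2l // ltr_norml.
have h0 : (0 : R) \in `[0, pi] by rewrite in_itv /= lexx pi_ge0.
have hp : (pi : R) \in `[0, pi] by rewrite in_itv /= pi_ge0 lexx.
have hj' : (j%:R * pi / N%:R : R) \in `[0, pi] by rewrite in_itv /= !ltW.
by apply/andP; split; [rewrite -cospi ltr_cos|rewrite -[X in _ < X]cos0 ltr_cos].
Qed.

End LevelOrder.

Section BandStructure.
Variable R : realType.
Variables (p : nat) (D : {poly R}) (C : R).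
Hypothesis hp : (0 < p)%N.
Hypothesis sizeD : size D = p.+1.
Hypothesis size_levels : forall N j, (0 < j < N)%N ->
  size (rootsR (D - (level R N j)%:P)) = p.
Hypothesis level_le : forall N j x, (0 < j < N)%N -> D.[x] = level R N j -> `|x| <= C.
Hypothesis level_simple : forall N j x, (0 < j < N)%N -> D.[x] = level R N j ->
  D^`().[x] != 0.

(** The height [level R 2 1], which is 0, provides a reference point on every band. *)
Let in12 : (0 < 1 < 2)%N. Proof. by []. Qed.

Let levelD_neq0 y : D - y%:P != 0.
Proof.
rewrite -size_poly_eq0 size_polyDl sizeD // size_polyN.
by rewrite (leq_ltn_trans (size_polyC_leq1 _)).
Qed.

(* [level_pt N j i] is the point at height [level N j] on the [i]-th band. *)
Definition level_pt N j i := nth 0 (rootsR (D - (level R N j)%:P)) i.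

(* The critical points of [D] separate the bands, so the index of the band
   containing [x] is the number of critical points to the left of [x]. *)
Definition band x := count (fun c => c < x) (rootsR D^`()).

Lemma horner_level_pt N j i : (0 < j < N)%N -> (i < p)%N ->
  D.[level_pt N j i] = level R N j.
Proof.
move=> jN ip; have : level_pt N j i \in rootsR (D - (level R N j)%:P).
  by rewrite mem_nth // size_levels.
by rewrite mem_rootsR // rootE !hornerE subr_eq0 => /eqP.
Qed.

Lemma level_pt_bound N j i : (0 < j < N)%N -> (i < p)%N -> `|level_pt N j i| <= C.
Proof. by move=> jN ip; apply: (level_le jN); exact: horner_level_pt. Qed.

Lemma sum_level_pt (V : nmodType) (g : R -> V) N j : (0 < j < N)%N ->
  \sum_(x <- rootsR (D - (level R N j)%:P)) g x = \sum_(i < p) g (level_pt N j i).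
Proof. by move=> jN; rewrite (big_nth 0) size_levels // big_mkord. Qed.

Let dD_neq0 : D^`() != 0.
Proof.
have /level_simple := horner_level_pt in12 hp.
by move=> /(_ in12); apply: contraNneq => ->; rewrite horner0.
Qed.

Lemma band_lt x : (band x < p)%N.
Proof.
rewrite /band (leq_ltn_trans (count_size _ _)) //.
have : (size (rootsR D^`()) < size D^`())%N.
  apply: max_poly_roots => //; last exact: uniq_rootsR.
  by apply/allP => c; rewrite mem_rootsR.
have : (size D^`() < size D)%N by rewrite lt_size_deriv // -size_poly_eq0 sizeD.
by rewrite sizeD ltnS => h1 h2; exact: leq_trans h2 h1.
Qed.

Lemma band_le x y : x <= y -> (band x <= band y)%N.
Proof. by move=> xy; apply: sub_count => c /= /lt_le_trans; apply. Qed.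

Lemma band_crit x y c : root D^`() c -> x <= c -> c < y -> (band x < band y)%N.
Proof.
move=> rc xc cy; have cin : c \in rootsR D^`() by rewrite mem_rootsR.
rewrite /band -!size_filter.
have -> : [seq z <- rootsR D^`() | z < x] =
    [seq z <- [seq z <- rootsR D^`() | z < y] | z < x].
  rewrite -filter_predI; apply: eq_filter => z /=; case: ltP => //= zx.
  by rewrite (lt_le_trans zx) // (le_trans xc) // ltW.
rewrite -(count_predC (fun z => z < x) [seq z <- rootsR D^`() | z < y]) size_filter.
rewrite -[X in (X < _)%N]addn0 ltn_add2l -has_count.
by apply/hasP; exists c; rewrite /= ?mem_filter ?cy // -leNgt.
Qed.

(** By Rolle a critical point separates two points of equal height, so along the [p] increasing
    level points the band index increases strictly. Being below [p], it runs through
    [0, ..., p - 1]. *)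
Lemma band_level_pt N j i : (0 < j < N)%N -> (i < p)%N -> band (level_pt N j i) = i.
Proof.
move=> jN ip; set s := rootsR (D - (level R N j)%:P).
have ss : size s = p by exact: size_levels.
suff E : map band s = iota 0 p.
  by rewrite /level_pt -/s -(nth_map 0 0%N) ?ss // E nth_iota.
have s_sorted : sorted <%R s by exact: sorted_roots.
have bs : sorted ltn (map band s).
  rewrite sorted_map; apply: (@sub_in_sorted _ (mem s) <%R) s_sorted; last exact/allP.
  move=> x y xs ys xy /=.
  have [|c] := @poly_rolle _ x y D xy.
    move: xs ys; rewrite !mem_rootsR // !rootE !hornerE !subr_eq0.
    by move=> /eqP -> /eqP ->.
  move=> cxy dc.
  move: cxy; rewrite in_itv /= => /andP[xc cy].
  by apply: (@band_crit _ _ c); rewrite ?rootE ?dc // ltW.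
have ubs : uniq (map band s) := sorted_uniq ltn_trans ltnn bs.
apply: (irr_sorted_eq ltn_trans ltnn) => //; first exact: iota_ltn_sorted.
apply: (uniq_min_size ubs _ _).2; last by rewrite size_map ss size_iota.
by move=> _ /mapP[x xs ->]; rewrite mem_iota add0n band_lt.
Qed.

Definition band_sign i : R := Num.sg D^`().[level_pt 2 1 i].

Lemma band_signP i : (i < p)%N -> band_sign i = 1 \/ band_sign i = -1.
Proof.
move=> ip; have := level_simple in12 (horner_level_pt in12 ip).
by rewrite /band_sign; case: sgrP => //; [left|right].
Qed.

(** If the derivative had the opposite sign at the reference point of the band, the intermediate
    value theorem would put a critical point between two points of the same band. *)
Lemma deriv_band_sign x : ~~ root D^`() x -> 0 < band_sign (band x) * D^`().[x].
Proof.
move=> xr; set i := band x; have ip : (i < p)%N := band_lt x.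
have y0 := level_simple in12 (horner_level_pt in12 ip).
have by_ := band_level_pt in12 ip.
rewrite /band_sign; set y := level_pt 2 1 i in y0 by_ *.
have x0 : D^`().[x] != 0 by [].
rewrite ltNge; apply/negP => h.
have neg : D^`().[y] * D^`().[x] < 0.
  by rewrite lt_neqAle mulf_neq0 //= {1}(numEsg D^`().[y]) mulrAC mulr_le0_ge0.
have [xy|yx|xy] := ltgtP x y.
- have [|c] := @poly_ivtoo _ D^`() x y (ltW xy); first by rewrite mulrC.
  rewrite in_itv /= => /andP[xc cy] rc.
  by have := band_crit rc (ltW xc) cy; rewrite by_ ltnn.
- have [//|c] := @poly_ivtoo _ D^`() y x (ltW yx).
  rewrite in_itv /= => /andP[xc cy] rc.
  by have := band_crit rc (ltW xc) cy; rewrite by_ ltnn.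
- by move: neg; rewrite xy -expr2 ltNge sqr_ge0.
Qed.

Lemma band_mono i x y : band x = i -> band y = i -> x < y ->
  band_sign i * D.[x] < band_sign i * D.[y].
Proof.
move=> bx by_ xy; have [c] := poly_mvt D xy.
rewrite in_itv /= => /andP[xc cy] E.
have bc : band c = i.
  by apply/eqP; rewrite eqn_leq -{1}by_ -bx !band_le // ltW.
have rc : ~~ root D^`() c.
  by apply/negP => rc; have := band_crit rc (lexx c) cy; rewrite bc by_ ltnn.
have := deriv_band_sign rc; rewrite bc => h.
by rewrite -subr_gt0 -mulrBr E mulrA mulr_gt0 // subr_gt0.
Qed.

Lemma band_mono_le i x y : band x = i -> band y = i ->
  (band_sign i * D.[x] <= band_sign i * D.[y]) = (x <= y).
Proof.
move=> bx by_; apply/idP/idP => [h|]; last first.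
  by rewrite le_eqVlt => /predU1P[-> //|xy]; rewrite ltW // band_mono.
by rewrite leNgt; apply/negP => /(band_mono by_ bx); rewrite ltNge h.
Qed.

Lemma band_mono_lt i x y : band x = i -> band y = i ->
  (band_sign i * D.[x] < band_sign i * D.[y]) = (x < y).
Proof. by move=> bx by_; rewrite !ltNge band_mono_le. Qed.

(** Half-open in height, so that consecutive cells of a band neither overlap nor leave a gap. *)
Definition cell N j i : set R :=
  [set x | band x = i /\ level R N j.+1 < D.[x] <= level R N j].

(** Whether [D] rises or falls along the band decides which level point is the left end and which
    end is closed. *)
Lemma cell_itv N j i : (0 < j)%N -> (j.+1 < N)%N -> (i < p)%N ->
  [/\ band_sign i = 1, level_pt N j.+1 i < level_pt N j i &
     cell N j i = [set` `]level_pt N j.+1 i, level_pt N j i] ]] \/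
  [/\ band_sign i = -1, level_pt N j i < level_pt N j.+1 i &
     cell N j i = [set` `[level_pt N j i, level_pt N j.+1 i[ ]].
Proof.
move=> j0 jN ip.
have h1 : (0 < j < N)%N by lia.
have h2 : (0 < j.+1 < N)%N by lia.
have b1 := band_level_pt h1 ip; have b2 := band_level_pt h2 ip.
have d1 := horner_level_pt h1 ip; have d2 := horner_level_pt h2 ip.
have lv : level R N j.+1 < level R N j by rewrite ltr_level.
have bx x y z : band x = i -> band z = i -> x <= y <= z -> band y = i.
  move=> hx hz /andP[xy yz].
  by apply/eqP; rewrite eqn_leq -{1}hz -hx !band_le.
case: (band_signP ip) => sE; [left|right]; split => //.
- by rewrite -(band_mono_lt b2 b1) sE !mul1r d1 d2.
- apply/seteqP; split => x /=; rewrite in_itv /=.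
    move=> [bxi]; rewrite -d1 -d2 => /andP[l1 l2].
    by rewrite -(band_mono_lt b2 bxi) -(band_mono_le bxi b1) sE !mul1r l1.
  move=> /andP[l1 l2]; have bxi : band x = i by apply: bx b2 b1 _; rewrite l2 ltW.
  by split => //; rewrite -d1 -d2 -[X in X < _]mul1r -[X in _ <= X]mul1r
    -[D.[x]]mul1r -sE (band_mono_lt b2 bxi) (band_mono_le bxi b1) l1.
- by rewrite -(band_mono_lt b1 b2) sE !mulN1r ltrN2 d1 d2.
- apply/seteqP; split => x /=; rewrite in_itv /=.
    move=> [bxi]; rewrite -d1 -d2 => /andP[l1 l2].
    by rewrite -(band_mono_lt bxi b2) -(band_mono_le b1 bxi) sE !mulN1r ltrN2 lerN2 l1 l2.
  move=> /andP[l1 l2]; have bxi : band x = i by apply: bx b1 b2 _; rewrite l1 ltW.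
  split => //; rewrite -d1 -d2; apply/andP; split.
    by rewrite -ltrN2 -[X in X < _]mulN1r -[X in _ < X]mulN1r -sE (band_mono_lt bxi b2).
  by rewrite -lerN2 -[X in X <= _]mulN1r -[X in _ <= X]mulN1r -sE (band_mono_le b1 bxi).
Qed.

(** Level points move monotonically along a band as [j] grows, so the lengths telescope. *)
Lemma sum_cell_length N i : (i < p)%N ->
  \sum_(1 <= j < N.-1) `|level_pt N j i - level_pt N j.+1 i| <= 2 * C.
Proof.
move=> ip; have C0 : 0 <= C.
  by apply: le_trans (level_pt_bound in12 hp).
case: (ltnP 1 N.-1) => N1; last by rewrite big_geq // mulr_ge0.
have -> : \sum_(1 <= j < N.-1) `|level_pt N j i - level_pt N j.+1 i| =
    \sum_(1 <= j < N.-1) ((- band_sign i * level_pt N j.+1 i) - (- band_sign i * level_pt N j i)).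
  apply: eq_big_nat => j /andP[j0 jN].
  have jN' : (j.+1 < N)%N by lia.
  have [[-> lt _]|[-> lt _]] := cell_itv j0 jN' ip.
    by rewrite gtr0_norm ?subr_gt0 //; ring.
  by rewrite ltr0_norm ?subr_lt0 //; ring.
rewrite telescope_sumr; last exact: ltnW.
have h1 : `|level_pt N 1 i| <= C by apply: level_pt_bound => //; lia.
have h2 : `|level_pt N N.-1 i| <= C by apply: level_pt_bound => //; lia.
move: h1 h2; rewrite !ler_norml => /andP[? ?] /andP[? ?].
by case: (band_signP ip) => ->; lra.
Qed.

End BandStructure.

(** * The density of states and its antiderivative *)

Section DosDensity.
Variable R : realType.
Variables (p : nat) (D : {poly R}).
Notation w := (dos_density p D).
Notation mu := (@lebesgue_measure R).

Lemma dos_density_ge0 x : 0 <= w x.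
Proof. by rewrite /dos_density !divr_ge0 ?mulr_ge0 ?divr_ge0 ?pi_ge0 // sqrtr_ge0. Qed.

(** Here the radicand is nonpositive, so [Num.sqrt] returns 0 and so does the division by it. The
    density thus vanishes at the band edges too, where the formula is singular. *)
Lemma dos_density_eq0 x : 2 <= `|D.[x]| -> w x = 0.
Proof.
move=> h; rewrite /dos_density ler0_sqrtr ?invr0 ?mulr0 ?mul0r //.
rewrite subr_le0 -real_normK ?num_real //.
by rewrite (_ : 4 = 2 ^+ 2) ?lerXn2r ?nnegrE //; ring.
Qed.

Lemma level_gap y : `|y| < 2 -> 0 < 4 - y ^+ 2 :> R.
Proof.
move=> h; rewrite subr_gt0 -real_normK ?num_real //.
by rewrite (_ : 4 = 2 ^+ 2) ?ltrXn2r //; ring.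
Qed.

Lemma dos_density_continuous x : `|D.[x]| < 2 -> {for x, continuous w}.
Proof.
move=> h; rewrite /dos_density.
apply: continuousM; last exact: cvg_cst.
apply: continuousM.
  apply: continuousM; first exact: cvg_cst.
  apply: (@continuous_comp _ _ _ (horner D^`()) Num.norm).
    exact: continuous_horner.
  exact: norm_continuous.
apply: continuousV; first by rewrite gt_eqF // sqrtr_gt0 level_gap.
apply: (@continuous_comp _ _ _ (fun x => 4 - D.[x] ^+ 2) Num.sqrt); last first.
  exact: sqrt_continuous.
apply: continuousB; first exact: cvg_cst.
apply: (@continuous_comp _ _ _ (horner D) (fun y => y ^+ 2)).
  exact: continuous_horner.
exact: exprn_continuous.
Qed.

Lemma measurable_dos_density : measurable_fun setT w.
Proof.
pose G := [set x | `|D.[x]| < 2].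
have oG : open G.
  apply: (@open_comp _ _ (fun x => `|D.[x]|) [set y | y < 2]); last exact: open_lt.
  move=> x _; apply: (@continuous_comp _ _ _ (horner D) Num.norm).
    exact: continuous_horner.
  exact: norm_continuous.
have -> : w = w \_ G.
  apply/funext => x; rewrite patchE; case: ifPn => //.
  by move=> /negP; rewrite in_setE => /negP; rewrite -leNgt => /dos_density_eq0.
apply/(measurable_restrictT _ (open_measurable oG)).
apply: open_continuous_measurable_fun => // x; rewrite inE.
exact: dos_density_continuous.
Qed.

(** An antiderivative is [- s / (p pi)] times [acos (D / 2)], with [s] the sign of the derivative of
    [D]. As [|D| < 2] up to both ends, the integrand is continuous on the closed interval and no
    improper integral arises. *)
Lemma dos_density_FTC (u v s : R) : (0 < p)%N -> u < v -> s = 1 \/ s = -1 ->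
  (forall x, u <= x <= v -> `|D.[x]| < 2) ->
  (forall x, u < x < v -> 0 <= s * D^`().[x]) ->
  (\int[mu]_(x in `[u, v]) (w x)%:E =
   ((p%:R * pi)^-1 * (s * (acos (D.[u] / 2) - acos (D.[v] / 2))))%:E)%E.
Proof.
move=> p0 uv hs hD hd.
pose F x := - (s / (p%:R * pi)) * acos (D.[x] / 2).
have half x : u <= x <= v -> -1 < D.[x] / 2 < 1.
  by move=> /hD; rewrite ltr_norml => /andP[? ?]; apply/andP; split; lra.
have dF x : u <= x <= v -> is_derive x 1 F
    (- (s / (p%:R * pi)) * (- (Num.sqrt (1 - (D.[x] / 2) ^+ 2))^-1 * (D^`().[x] / 2))).
  move=> hx; apply: is_deriveZ.
  apply: (@is_derive1_comp _ acos (fun x => D.[x] / 2)).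
    by apply: is_derive1_acos; exact: half.
  have -> : (fun x => D.[x] / 2) = (2^-1 \*: horner D).
    by apply/funext => y /=; rewrite mulrC.
  by rewrite mulrC; exact: is_deriveZ.
have cF x : u <= x <= v -> {for x, continuous F}.
  move=> hx; apply/differentiable_continuous/derivable1_diffP.
  by have [] := dF x hx.
rewrite (continuous_FTC2 (F := F)) //.
- by rewrite -EFinB /F; congr EFin; rewrite invfM; ring.
- apply: continuous_in_subspaceT => x; rewrite inE /= in_itv /= => hx.
  exact: dos_density_continuous (hD x hx).
- split.
  + move=> x; rewrite in_itv /= => /andP[ux xv].
    by have [] := dF x; rewrite // !ltW.
  + by apply: cvg_at_right_filter; apply: cF; rewrite lexx ltW.
  + by apply: cvg_at_left_filter; apply: cF; rewrite lexx ltW.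
- move=> x; rewrite in_itv /= => xuv; have /andP[ux xv] := xuv.
  have hx : u <= x <= v by rewrite !ltW.
  have [_ dFx] := dF x hx.
  rewrite derive1E dFx /dos_density.
  have -> : `|D^`().[x]| = s * D^`().[x].
    rewrite -[RHS]ger0_norm ?hd // normrM.
    by case: hs => ->; rewrite ?normrN normr1 mul1r.
  have -> : Num.sqrt (1 - (D.[x] / 2) ^+ 2) = Num.sqrt (4 - D.[x] ^+ 2) / 2.
    have -> : 1 - (D.[x] / 2) ^+ 2 = (4 - D.[x] ^+ 2) * (2^-1) ^+ 2 by field.
    by rewrite sqrtrM ?ltW ?level_gap ?hD // sqrtr_sqr ger0_norm.
  have q0 : Num.sqrt (4 - D.[x] ^+ 2) != 0.
    by rewrite gt_eqF // sqrtr_gt0 level_gap // hD.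
  have pi0 : (pi : R) != 0 by rewrite gt_eqF // pi_gt0.
  have pp0 : (p%:R : R) != 0 by rewrite pnatr_eq0; lia.
  rewrite /GRing.scale /=; move: (pi : R) (Num.sqrt _) pi0 q0 => P S P0 S0.
  by field; rewrite P0 S0 pp0.
Qed.

End DosDensity.

(** The bound on [g] is asked only where [f] is nonzero, since the test functions include powers,
    which are bounded on the support of the density but not on the line. *)
Lemma integrable_bounded_mul d (T : measurableType d) (R : realType)
    (m : {measure set T -> \bar R}) (A : set T) (f g : T -> R) (K : R) :
  measurable A -> m.-integrable A (EFin \o f) -> measurable_fun A g ->
  (forall x, A x -> f x != 0 -> `|g x| <= K) -> m.-integrable A (EFin \o (fun x => g x * f x)).
Proof.
move=> mA intf mg gK.
have mf : measurable_fun A f by apply/measurable_EFinP; exact: measurable_int intf.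
apply: (@le_integrable _ _ _ _ _ _ _ (EFin \o (fun x => K * f x))) => //.
- by apply/measurable_EFinP; exact: measurable_funM.
- move=> x Ax /=; rewrite lee_fin !normrM.
  have [->|f0] := eqVneq (f x) 0; first by rewrite normr0 !mulr0.
  apply: ler_wpM2r => //.
  by apply: le_trans (gK x Ax f0) _; rewrite ler_norm.
- rewrite [X in _.-integrable _ X](_ : _ = (fun x => K%:E * (EFin \o f) x)%E) //.
  exact: integrableZl.
Qed.

Lemma norm_Rintegral_bounded_mul d (T : measurableType d) (R : realType)
    (m : {measure set T -> \bar R}) (A : set T) (f g : T -> R) (K : R) :
  measurable A -> m.-integrable A (EFin \o f) -> measurable_fun A g ->
  (forall x, A x -> 0 <= f x) -> (forall x, A x -> f x != 0 -> `|g x| <= K) ->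
  `|\int[m]_(x in A) (g x * f x)| <= K * \int[m]_(x in A) f x.
Proof.
move=> mA intf mg f0 gK; have intgf := integrable_bounded_mul mA intf mg gK.
apply: le_trans (le_normr_Rintegral mA intgf) _.
rewrite -RintegralZl //; apply: le_Rintegral => //.
- exact: integrable_norm.
- rewrite [X in _.-integrable _ X](_ : _ = (fun x => K%:E * (EFin \o f) x)%E) //.
  exact: integrableZl.
- move=> x Ax; rewrite normrM (ger0_norm (f0 x Ax)).
  have [->|fx0] := eqVneq (f x) 0; first by rewrite !mulr0.
  by apply: ler_wpM2r; [exact: f0 | exact: gK].
Qed.

(** * Mass of the cells and Riemann sums for the density of states *)

Section DosMeasure.
Variable R : realType.
Variables (p : nat) (D : {poly R}) (C : R).
Hypothesis hp : (0 < p)%N.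
Hypothesis sizeD : size D = p.+1.
Hypothesis size_levels : forall N j, (0 < j < N)%N ->
  size (rootsR (D - (level R N j)%:P)) = p.
Hypothesis level_le : forall N j x, (0 < j < N)%N -> D.[x] = level R N j -> `|x| <= C.
Hypothesis level_simple : forall N j x, (0 < j < N)%N -> D.[x] = level R N j ->
  D^`().[x] != 0.

Notation w := (dos_density p D).
Notation mu := (@lebesgue_measure R).
Notation pt := (level_pt D).
Notation cl := (cell D).

Let measurable_w (A : set R) : measurable A -> measurable_fun A (EFin \o w).
Proof.
move=> mA; apply/measurable_EFinP; apply: measurable_funS (measurable_dos_density p D) => //.
Qed.

Lemma measurable_cell N j i : (0 < j)%N -> (j.+1 < N)%N -> (i < p)%N ->
  measurable (cl N j i).
Proof.
move=> j0 jN ip.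
by have [[_ _ ->]|[_ _ ->]] :=
  cell_itv hp sizeD size_levels level_simple j0 jN ip.
Qed.

Lemma acos_level N j : (0 < j < N)%N -> acos (level R N j / 2) = j%:R * pi / N%:R.
Proof.
move=> jN; have /andP[j1 j2] := level_angle R jN.
rewrite /level mulrC mulrA mulVf // mul1r cosK // in_itv /=.
by rewrite !ltW.
Qed.

Lemma cell_mass N j i : (0 < j)%N -> (j.+1 < N)%N -> (i < p)%N ->
  (\int[mu]_(x in cl N j i) (w x)%:E = ((N%:R * p%:R)^-1)%:E)%E.
Proof.
move=> j0 jN ip.
have h1 : (0 < j < N)%N by lia.
have h2 : (0 < j.+1 < N)%N by lia.
have d1 := horner_level_pt hp sizeD size_levels h1 ip.
have d2 := horner_level_pt hp sizeD size_levels h2 ip.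
have b1 := band_level_pt hp sizeD size_levels level_simple h1 ip.
have b2 := band_level_pt hp sizeD size_levels level_simple h2 ip.
have lvl y : level R N j.+1 <= y <= level R N j -> `|y| < 2.
  have := level_bound R h1; have := level_bound R h2.
  rewrite !ltr_norml => /andP[? ?] /andP[? ?] /andP[? ?].
  by apply/andP; split; lra.
have pi0 : (pi : R) != 0 by rewrite gt_eqF // pi_gt0.
have pp0 : (p%:R : R) != 0 by rewrite pnatr_eq0; lia.
have N0 : (N%:R : R) != 0 by rewrite pnatr_eq0; lia.
(* The sign of the antiderivative cancels against the orientation of the cell, so both cases reduce
   to the angle difference [pi / N]. *)
have final s : s * s = 1 -> (p%:R * pi)^-1 *
    (s * (s * (acos (level R N j.+1 / 2) - acos (level R N j / 2)))) = (N%:R * p%:R)^-1.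
  move=> ss; rewrite [s * (s * _)]mulrA ss mul1r !acos_level // -natr1.
  by move: (pi : R) pi0 => P P0; field; rewrite N0 P0 pp0.
have inb x : Num.min (pt N j i) (pt N j.+1 i) <= x <= Num.max (pt N j i) (pt N j.+1 i) ->
    band D x = i.
  move=> /andP[xl xr]; apply/eqP; rewrite eqn_leq.
  have := band_le D xl; have := band_le D xr.
  by rewrite minEle maxEle; case: ifP => _; rewrite ?b1 ?b2 => -> ->.
have sgn x : Num.min (pt N j i) (pt N j.+1 i) < x < Num.max (pt N j i) (pt N j.+1 i) ->
    0 <= band_sign D i * D^`().[x].
  move=> /andP[xl xr]; have bx : band D x = i by apply: inb; rewrite !ltW.
  have rc : ~~ root D^`() x.
    apply/negP => rc.
    have := band_crit hp sizeD size_levels level_simple rc (lexx x) xr.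
    by rewrite bx (inb (Num.max _ _)) ?ltnn // lexx andbT ltW // (lt_trans xl).
  have := deriv_band_sign hp sizeD size_levels level_simple rc.
  by rewrite bx => /ltW.
have bml := band_mono_le hp sizeD size_levels level_simple.
have [[sE lt ->]|[sE lt ->]] :=
  cell_itv hp sizeD size_levels level_simple j0 jN ip.
- rewrite integral_itv_obnd_cbnd; last exact: measurable_w.
  rewrite (dos_density_FTC hp lt (or_introl erefl)) ?d1 ?d2.
  + by congr EFin; rewrite -(final 1) ?mulr1 // !mul1r.
  + move=> x /andP[x1 x2].
    have bx : band D x = i by apply: inb; rewrite minEle maxEle (leNgt (pt N j i)) lt /= x1 x2.
    apply: lvl; rewrite -d1 -d2 -[X in X <= _ <= _]mul1r -[X in _ <= X <= _]mul1r.
    by rewrite -[X in _ <= _ <= X]mul1r -sE !bml // x1 x2.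
  + move=> x /andP[x1 x2]; rewrite -sE; apply: sgn.
    by rewrite minEle maxEle (leNgt (pt N j i)) lt /= x1 x2.
- rewrite integral_itv_bndo_bndc; last exact: measurable_w.
  rewrite (dos_density_FTC hp lt (or_intror erefl)) ?d1 ?d2.
  + by congr EFin; rewrite -(final 1) ?mulr1 // !mul1r mulN1r opprB.
  + move=> x /andP[x1 x2].
    have bx : band D x = i by apply: inb; rewrite minEle maxEle (ltW lt) /= x1 x2.
    apply: lvl; rewrite -d1 -d2 -lerN2 -[X in _ && X]lerN2.
    by rewrite -[- D.[x]]mulN1r -[- _.[pt N j i]]mulN1r -[- _.[pt N j.+1 i]]mulN1r
      -sE !bml // x1 x2.
  + move=> x /andP[x1 x2]; rewrite -sE; apply: sgn.
    by rewrite minEle maxEle (ltW lt) /= x1 x2.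
Qed.

Lemma cell_near N j i x : (0 < j)%N -> (j.+1 < N)%N -> (i < p)%N -> cl N j i x ->
  `|x - pt N j i| <= `|pt N j i - pt N j.+1 i| /\ `|x| <= C.
Proof.
move=> j0 jN ip.
have h1 : (0 < j < N)%N by lia.
have h2 : (0 < j.+1 < N)%N by lia.
have := level_pt_bound hp sizeD size_levels level_le h1 ip.
have := level_pt_bound hp sizeD size_levels level_le h2 ip.
rewrite !ler_norml => /andP[? ?] /andP[? ?].
have [[_ lt ->]|[_ lt ->]] :=
  cell_itv hp sizeD size_levels level_simple j0 jN ip;
  rewrite /= in_itv /= => /andP[x1 x2].
- rewrite gtr0_norm ?subr_gt0 //.
  by split; apply/andP; split; lra.
- rewrite ltr0_norm ?subr_lt0 //.
  by split; apply/andP; split; lra.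
Qed.

Let integrable_w N j i : (0 < j)%N -> (j.+1 < N)%N -> (i < p)%N ->
  mu.-integrable (cl N j i) (EFin \o w).
Proof.
move=> j0 jN ip; have mc := measurable_cell j0 jN ip.
apply/integrableP; split; first exact: measurable_w.
under eq_integral do rewrite /= ger0_norm ?dos_density_ge0 //.
by rewrite cell_mass // ltry.
Qed.

Lemma cell_integral N j i (g : R -> R) (e : R) :
  (0 < j)%N -> (j.+1 < N)%N -> (i < p)%N -> measurable_fun setT g ->
  (forall x, cl N j i x -> `|g x - g (pt N j i)| <= e) ->
  `|\int[mu]_(x in cl N j i) (g x * w x) - (N%:R * p%:R)^-1 * g (pt N j i)|
  <= e * (N%:R * p%:R)^-1.
Proof.
move=> j0 jN ip mg ge; have mc := measurable_cell j0 jN ip.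
have iw := integrable_w j0 jN ip.
have wE : \int[mu]_(x in cl N j i) w x = (N%:R * p%:R)^-1.
  by rewrite /Rintegral cell_mass.
have mg' : measurable_fun (cl N j i) (fun x => g x - g (pt N j i)).
  by apply: measurable_funB => //; apply: measurable_funS mg.
have -> : \int[mu]_(x in cl N j i) (g x * w x) - (N%:R * p%:R)^-1 * g (pt N j i) =
    \int[mu]_(x in cl N j i) ((g x - g (pt N j i)) * w x).
  rewrite -wE mulrC -RintegralZl //.
  rewrite -RintegralB //; last 2 first.
  - apply: (@integrable_bounded_mul _ _ _ _ _ _ _ (e + `|g (pt N j i)|)) => //.
      exact: measurable_funS mg.
    move=> x /ge h _; rewrite -[g x](subrK (g (pt N j i))).
    by rewrite (le_trans (ler_normD _ _)) // lerD2r.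
  - apply: (@integrable_bounded_mul _ _ _ _ _ _ (fun=> _) `|g (pt N j i)|) => //.
  by apply: eq_Rintegral => x _; rewrite mulrBl.
rewrite -wE; apply: norm_Rintegral_bounded_mul => // x cx.
  exact: dos_density_ge0.
by move=> _; exact: ge.
Qed.

(** The part of the bands filled by the cells with [0 < j < N - 1]; it is empty for [N = 2]. *)
Definition inner_spectrum N : set R :=
  [set x | level R N N.-1 < D.[x] <= level R N 1].

Let cells N := [seq (i, j) | i <- iota 0 p, j <- iota 1 (N - 2)].

Let mem_cells N ij : (ij \in cells N) = [&& (ij.1 < p)%N, (0 < ij.2)%N & (ij.2.+1 < N)%N].
Proof.
case: ij => i j; rewrite /cells; apply/allpairsP/idP => /=.
  by move=> [[i' j']] /= [+ + [-> ->]]; rewrite !mem_iota; lia.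
by move=> h; exists (i, j) => /=; split => //; rewrite mem_iota; lia.
Qed.

(** The extension by [set0] makes the family measurable at every index, as the formula for integrals
    over a finite union asks. *)
Let F N (ij : nat * nat) := if ij \in cells N then cl N ij.2 ij.1 else set0.

Let measurable_F N ij : measurable (F N ij).
Proof.
rewrite /F mem_cells; case: ifP => // /and3P[h1 h2 h3].
exact: measurable_cell.
Qed.

Let trivF N : trivIset [set` cells N] (F N).
Proof.
move=> [i j] [i' j'] /= hs hs' [x []]; rewrite /F hs hs'.
move: hs hs'; rewrite !mem_cells /= => /and3P[_ h2 h3] /and3P[_ h2' h3'].
move=> [<- /andP[l1 l2]] [<- /andP[l1' l2']]; congr (_, _).
apply/eqP; rewrite eqn_leq; apply/andP; split; rewrite leqNgt; apply/negP => jj.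
- have := lt_le_trans l1' l2; rewrite ltr_level //; lia.
- have := lt_le_trans l1 l2'; rewrite ltr_level //; lia.
Qed.

Let inner_cells N : (1 < N)%N -> \big[setU/set0]_(ij <- cells N) F N ij = inner_spectrum N.
Proof.
move=> N1; rewrite -bigcup_seq; apply/seteqP; split => x /=.
  move=> [[i j] /= hs]; rewrite /F hs; move: hs; rewrite mem_cells /=.
  move=> /and3P[_ h2 h3] [_ /andP[l1 l2]]; rewrite /inner_spectrum /=.
  apply/andP; split; [apply: le_lt_trans l1|apply: le_trans l2 _];
    rewrite ler_level; lia.
move=> /andP[l1 l2].
(* The cell of [x] is found from the least such [j]: minimality gives [D.[x] <= level R N j]. *)
have ex : exists j, (0 < j)%N && (level R N j.+1 < D.[x]).
  case: (ltnP 2 N) => N2.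
    by exists N.-2; apply/andP; split; [lia|rewrite (_ : N.-2.+1 = N.-1) //; lia].
  exfalso; move: (lt_le_trans l1 l2); rewrite (_ : N.-1 = 1)%N ?ltxx //; lia.
case: (ex_minnP ex) => j /andP[j0 lj] jmin.
have jN : (j.+1 < N)%N.
  have := jmin N.-2; case: (ltnP 2 N) => N2.
    rewrite (_ : N.-2.+1 = N.-1) ?l1; last by lia.
    by rewrite (_ : (0 < N.-2)%N) //; last (by lia); move=> /(_ isT); lia.
  exfalso; move: (lt_le_trans l1 l2); rewrite (_ : N.-1 = 1)%N ?ltxx //; lia.
exists (band D x, j) => /=.
  by rewrite mem_cells /= j0 jN (band_lt hp sizeD size_levels level_simple).
rewrite /F mem_cells /= j0 jN (band_lt hp sizeD size_levels level_simple) /=.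
split => //; rewrite lj /=.
case: j j0 lj jmin jN => [//|[//|j]] _ lj jmin jN.
by rewrite leNgt; apply/negP => h; have := jmin j.+1; rewrite h => /(_ isT); lia.
Qed.

Lemma measurable_inner_spectrum N : (1 < N)%N -> measurable (inner_spectrum N).
Proof.
by move=> N1; rewrite -inner_cells //; apply: bigsetU_measurable => ij _.
Qed.

Lemma inner_integral N (h : R -> R) : (1 < N)%N -> measurable_fun setT h ->
  (\int[mu]_(x in inner_spectrum N) (h x)%:E =
   \sum_(0 <= i < p) \sum_(1 <= j < N.-1) \int[mu]_(x in cl N j i) (h x)%:E)%E.
Proof.
move=> N1 mh; rewrite -inner_cells // integral_bigsetU_EFin; last 4 first.
- exact: measurable_F.
- by apply: allpairs_uniq; rewrite ?iota_uniq // => -[? ?] [? ?] _ _.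
- exact: trivF.
- by apply/measurable_EFinP; apply: measurable_funS mh.
rewrite (eq_big_seq (fun ij => \int[mu]_(x in cl N ij.2 ij.1) (h x)%:E)%E); last first.
  by move=> ij hij; rewrite /F hij.
by rewrite /cells big_allpairs /index_iota subn0 (_ : N.-1 - 1 = N - 2)%N; last by lia.
Qed.

Lemma inner_spectrum_bound N x : (1 < N)%N -> inner_spectrum N x -> `|x| <= C.
Proof.
move=> N1; rewrite -inner_cells // -bigcup_seq => -[[i j] /= hs].
rewrite /F hs; move: hs; rewrite mem_cells /= => /and3P[h1 h2 h3] cx.
exact: (cell_near h2 h3 h1 cx).2.
Qed.

(** There are [p (N - 2)] cells, each of mass [1 / (N p)]. *)
Lemma inner_mass N : (1 < N)%N ->
  (\int[mu]_(x in inner_spectrum N) (w x)%:E = (1 - 2 / N%:R)%:E)%E.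
Proof.
move=> N1; rewrite -inner_cells // integral_bigsetU_EFin; last 4 first.
- exact: measurable_F.
- by apply: allpairs_uniq; rewrite ?iota_uniq // => -[? ?] [? ?] _ _.
- exact: trivF.
- by apply: measurable_w; rewrite inner_cells //; exact: measurable_inner_spectrum.
rewrite (eq_big_seq (fun=> ((N%:R * p%:R)^-1)%:E)); last first.
  move=> ij hij; rewrite /F hij; move: hij; rewrite mem_cells => /and3P[h1 h2 h3].
  exact: cell_mass.
rewrite sumEFin big_const_seq count_predT size_allpairs !size_iota iter_addr_0.
congr EFin; rewrite -[LHS]mulr_natr natrM natrB //.
have N0 : (N%:R : R) != 0 by rewrite pnatr_eq0; lia.
have pp0 : (p%:R : R) != 0 by rewrite pnatr_eq0; lia.
by field; rewrite N0 pp0.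
Qed.

(** Writing [|y| = 2 cos t] with [t > 0], it suffices that [pi / N < t]. *)
Lemma level_first_near1 (y : R) : `|y| < 2 -> exists N, (1 < N)%N /\ `|y| < level R N 1.
Proof.
move=> y2; pose t := acos (`|y| / 2).
have hy : -1 <= `|y| / 2 < 1.
  by have := normr_ge0 y; move: y2; move=> ? ?; apply/andP; split; lra.
have t0 : 0 < t by exact: acos_gt0.
have tpi : t <= pi by apply: acos_lepi; case/andP: hy => -> /ltW ->.
have pt0 : 0 <= pi / t by rewrite divr_ge0 // ?pi_ge0 // ltW.
exists (Num.bound (pi / t)).+2; split => //.
have lt : (0 : R) < (Num.bound (pi / t)).+2%:R by rewrite ltr0n.
have hN : pi < t * (Num.bound (pi / t)).+2%:R.
  rewrite mulrC -ltr_pdivrMr // (lt_trans (archi_boundP pt0)) // ltr_nat; lia.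
have a1 : pi / (Num.bound (pi / t)).+2%:R < t by rewrite ltr_pdivrMr.
have yE : `|y| = 2 * cos t by rewrite acosK ?in_itv /=; [field|case/andP: hy => -> /ltW ->].
rewrite yE /level mul1r ltr_pM2l // ltr_cos //; rewrite in_itv /=; apply/andP; split => //.
- by rewrite divr_ge0 ?pi_ge0.
- by rewrite (le_trans _ tpi) // ltW.
- exact: ltW.
Qed.

Lemma level_last N : (1 < N)%N -> level R N N.-1 = - level R N 1.
Proof.
move=> N1; rewrite /level -mulrN; congr (_ * _).
have N0 : (N%:R : R) != 0 by rewrite pnatr_eq0; lia.
have -> : N.-1%:R * pi / N%:R = pi - 1%:R * pi / N%:R :> R.
  have -> : N.-1%:R = N%:R - 1 :> R by rewrite -subn1 natrB // ltnW.
  by move: (pi : R) => P; field.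
by rewrite cosB cospi sinpi mul0r addr0 mulN1r.
Qed.

Lemma inner_spectrum_nondecreasing : nondecreasing_seq (fun n => inner_spectrum n.+2).
Proof.
apply/nondecreasing_seqP => n; apply/subsetPset => x.
rewrite /inner_spectrum /= !level_last //.
suff h : level R n.+2 1 <= level R n.+3 1 by move=> /andP[? ?]; apply/andP; split; lra.
have := level_angle R (isT : (0 < 1 < n.+2)%N).
have := level_angle R (isT : (0 < 1 < n.+3)%N).
rewrite /level => /andP[? ?] /andP[? ?]; rewrite ler_pM2l // leNgt ltr_cos ?in_itv /= ?ltW // -leNgt.
rewrite !mul1r ler_pM2l ?pi_gt0 // lef_pV2 ?posrE ?ltr0n // ler_nat; lia.
Qed.

Lemma bigcup_inner_spectrum : \bigcup_n inner_spectrum n.+2 = [set x | `|D.[x]| < 2].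
Proof.
apply/seteqP; split => x /=.
  move=> [n _]; rewrite /inner_spectrum /= level_last // => /andP[h1 h2].
  have : `|D.[x]| <= level R n.+2 1 by rewrite ler_norml h2 ltW.
  move=> /le_lt_trans; apply; apply: le_lt_trans (ler_norm _) _.
  exact: level_bound.
move=> /level_first_near1[N [N1 hN]]; exists N.-2 => //.
rewrite (_ : N.-2.+2 = N); last by lia.
rewrite /inner_spectrum /= level_last //; move: hN; rewrite ltr_norml.
by move=> /andP[-> /ltW ->].
Qed.

Lemma restrict_dos_density (f : R -> R) :
  (fun x => (f x * w x)%:E) = ((fun x => (f x * w x)%:E) \_ [set x | `|D.[x]| < 2]).
Proof.
apply/funext => x; rewrite patchE; case: ifPn => //.
move=> /negP; rewrite in_setE /= => /negP; rewrite -leNgt => /dos_density_eq0 ->.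
by rewrite mulr0.
Qed.

(** The inner spectra increase to the set where [|D| < 2], off which the density vanishes, so
    monotone convergence gives the limit of [1 - 2 / N]. *)
Lemma dos_mass : (\int[mu]_x (w x)%:E = 1)%E.
Proof.
have -> : (fun x => (w x)%:E) = (fun x => (w x)%:E) \_ [set x | `|D.[x]| < 2].
  by have := restrict_dos_density (cst 1); under eq_fun do rewrite mul1r.
rewrite -integral_mkcond -bigcup_inner_spectrum.
have lim1 : (\int[mu]_(x in inner_spectrum n.+2) (EFin \o w) x)%E @[n --> \oo] -->
    (\int[mu]_(x in \bigcup_n inner_spectrum n.+2) (EFin \o w) x)%E.
  apply: ge0_nondecreasing_set_cvg_integral.
  - exact: inner_spectrum_nondecreasing.
  - by move=> n; exact: measurable_inner_spectrum.
  - by move=> n; apply: measurable_w; exact: measurable_inner_spectrum.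
  - by move=> n x _; rewrite lee_fin dos_density_ge0.
have lim2 : (\int[mu]_(x in inner_spectrum n.+2) (EFin \o w) x)%E @[n --> \oo] --> 1%:E.
  under eq_fun do rewrite inner_mass //.
  apply: cvg_EFin; first by near=> n.
  rewrite -[X in _ --> X]subr0 -[X in _ - X](mulr0 2).
  apply: cvgB; first exact: cvg_cst.
  apply: cvgM; first exact: cvg_cst.
  by have h := @cvg_harmonic R; rewrite -cvg_shiftS in h.
exact: cvg_unique lim1 lim2.
Unshelve. all: by end_near.
Qed.

Lemma dos_support x : w x != 0 -> `|x| <= C.
Proof.
move=> wx; have : [set x | `|D.[x]| < 2] x.
  by rewrite /= ltNge; apply: contraNN wx => /dos_density_eq0 ->.
rewrite -bigcup_inner_spectrum => -[n _]; exact: inner_spectrum_bound.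
Qed.

Lemma integrable_dos : mu.-integrable setT (EFin \o w).
Proof.
apply/integrableP; split; first exact: measurable_w.
under eq_integral do rewrite /= ger0_norm ?dos_density_ge0 //.
by rewrite dos_mass ltry.
Qed.

(** A cell contributes an error of at most [L / (N p)] times its length, and the lengths on one band
    sum to at most [2 * C]. So the error stays bounded even after multiplication by [N p]. *)
Lemma level_sum_integral (g : R -> R) (B L : R) : measurable_fun setT g -> 0 <= L ->
  (forall x, `|x| <= C -> `|g x| <= B) ->
  (forall x y, `|x| <= C -> `|y| <= C -> `|g x - g y| <= L * `|x - y|) ->
  exists K : R, forall N, (1 < N)%N ->
    `|\sum_(1 <= j < N) \sum_(x <- rootsR (D - (level R N j)%:P)) g x
      - N%:R * (p%:R * \int[mu]_x (g x * w x))| <= K.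
Proof.
move=> mg L0 gB gL.
have C0 : 0 <= C.
  by apply: le_trans (level_pt_bound hp sizeD size_levels level_le (N := 2) (j := 1) isT hp).
have B0 : 0 <= B by apply: le_trans (gB 0 _) => //; rewrite normr0.
have gBw x : w x != 0 -> `|g x| <= B by move=> /dos_support; exact: gB.
have igw : mu.-integrable setT (EFin \o (fun x => g x * w x)).
  by apply: (integrable_bounded_mul _ integrable_dos mg) => // x _; exact: gBw.
(* One [B] is for the points of level [N - 1], which tag no cell, and two are for the mass [2 / N]
   outside the cells; [2 * C * L] is the error inside them. *)
exists (p%:R * (3 * B + 2 * C * L)) => N N1.
have N0 : (0 : R) < N%:R by rewrite ltr0n; lia.
have p0 : (0 : R) < p%:R by rewrite ltr0n.
have mI := measurable_inner_spectrum N1.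
have split_inner (f : R -> R) : mu.-integrable setT (EFin \o f) ->
    \int[mu]_x f x = \int[mu]_(x in inner_spectrum N) f x
      + \int[mu]_(x in ~` inner_spectrum N) f x.
  move=> fi; rewrite -[in LHS](setUv (inner_spectrum N)) Rintegral_setU //.
  - by apply: measurableC.
  - by rewrite setUv.
  - by apply/disj_setPCl; exact: subset_refl.
have outer : `|\int[mu]_(x in ~` inner_spectrum N) (g x * w x)| <= B * (2 / N%:R).
  have -> : 2 / N%:R = \int[mu]_(x in ~` inner_spectrum N) w x.
    have := split_inner w integrable_dos.
    by rewrite /Rintegral dos_mass inner_mass //=; lra.
  apply: norm_Rintegral_bounded_mul.
  - by apply: measurableC; exact: measurable_inner_spectrum.
  - by apply: integrableS integrable_dos => //; apply: measurableC; exact: measurable_inner_spectrum.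
  - exact: measurable_funS mg.
  - by move=> x _; exact: dos_density_ge0.
  - by move=> x _; exact: gBw.
have inner : \int[mu]_(x in inner_spectrum N) (g x * w x) =
    \sum_(0 <= i < p) \sum_(1 <= j < N.-1) \int[mu]_(x in cl N j i) (g x * w x).
  rewrite {1}/Rintegral inner_integral //; last first.
    by apply: measurable_funM => //; apply/measurable_EFinP; exact: measurable_w.
  rewrite [X in fine X](_ : _ =
    (\sum_(0 <= i < p) \sum_(1 <= j < N.-1) \int[mu]_(x in cl N j i) (g x * w x))%:E) //.
  rewrite -sumEFin; apply: eq_big_nat => i /andP[_ ip].
  rewrite -sumEFin; apply: eq_big_nat => j /andP[j0 jN].
  have jN' : (j.+1 < N)%N by lia.
  rewrite /Rintegral fineK //; apply: integrable_fin_num.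
    exact: measurable_cell.
  by apply: integrableS igw => //; exact: measurable_cell.
have innerE : `|\int[mu]_(x in inner_spectrum N) (g x * w x) - (N%:R * p%:R)^-1 *
    \sum_(0 <= i < p) \sum_(1 <= j < N.-1) g (pt N j i)| <= 2 * C * L / N%:R.
  rewrite inner mulr_sumr -sumrB; apply: le_trans (ler_norm_sum _ _ _) _.
  have -> : 2 * C * L / N%:R = \sum_(0 <= i < p) (2 * C * L / (N%:R * p%:R)).
    rewrite sumr_const_nat subn0 -[RHS]mulr_natr.
    by move: p0 N0 => /lt0r_neq0 p0 /lt0r_neq0 N0; field; rewrite N0 p0.
  apply: ler_sum_nat => i /andP[_ ip].
  rewrite mulr_sumr -sumrB; apply: le_trans (ler_norm_sum _ _ _) _.
  apply: (@le_trans _ _ (\sum_(1 <= j < N.-1)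
      (L / (N%:R * p%:R)) * `|pt N j i - pt N j.+1 i|)).
    apply: ler_sum_nat => j /andP[j0 jN]; have jN' : (j.+1 < N)%N by lia.
    rewrite mulrAC; apply: cell_integral => // x cx.
    have [h1 h2] := cell_near j0 jN' ip cx.
    apply: le_trans (gL _ _ h2 _) _; last by rewrite ler_wpM2l.
    by apply: (level_pt_bound hp sizeD size_levels level_le _ ip); lia.
  rewrite -mulr_sumr -[X in _ <= X / _]mulrA [X in _ <= X]mulrAC mulrC.
  rewrite [X in _ <= X](_ : _ = 2 * C * (L / (N%:R * p%:R))); last by ring.
  apply: ler_wpM2r; first by rewrite divr_ge0 // mulr_ge0 // ltW.
  exact: (sum_cell_length hp sizeD size_levels level_le level_simple).
have lastE : `|\sum_(0 <= i < p) g (pt N N.-1 i)| <= p%:R * B.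
  apply: le_trans (ler_norm_sum _ _ _) _.
  have -> : p%:R * B = \sum_(0 <= i < p) B by rewrite sumr_const_nat subn0 mulr_natl.
  apply: ler_sum_nat => i /andP[_ ip]; apply: gB.
  by apply: (level_pt_bound hp sizeD size_levels level_le _ ip); lia.
have -> : \sum_(1 <= j < N) \sum_(x <- rootsR (D - (level R N j)%:P)) g x =
    \sum_(0 <= i < p) \sum_(1 <= j < N.-1) g (pt N j i)
     + \sum_(0 <= i < p) g (pt N N.-1 i).
  rewrite (eq_big_nat _ _ (F2 := fun j => \sum_(0 <= i < p) g (pt N j i))); last first.
    by move=> j jN; rewrite (sum_level_pt size_levels) // big_mkord.
  rewrite -{1}(prednK (ltnW N1)) big_nat_recr /=; last by lia.
  by rewrite exchange_big_nat.
rewrite (split_inner _ igw).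
move: innerE outer lastE.
set I1 := \int[mu]_(x in inner_spectrum N) _; set I2 := \int[mu]_(x in _) _.
set S1 := \sum_(0 <= i < p) \sum_(1 <= j < N.-1) _; set S2 := \sum_(0 <= i < p) _.
move=> h1 h2 h3.
have -> : S1 + S2 - N%:R * (p%:R * (I1 + I2)) =
   S2 - (N%:R * p%:R) * (I1 - (N%:R * p%:R)^-1 * S1) - (N%:R * p%:R) * I2.
  by move: p0 N0 => /lt0r_neq0 p0 /lt0r_neq0 N0; field; rewrite N0 p0.
have Np0 : 0 <= N%:R * p%:R :> R by rewrite mulr_ge0 // ltW.
apply: le_trans (ler_normB _ _) _; rewrite normrM (ger0_norm Np0).
apply: le_trans (lerD (ler_normB _ _) (ler_wpM2l Np0 h2)) _.
rewrite normrM (ger0_norm Np0).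
apply: le_trans (lerD (lerD h3 (ler_wpM2l Np0 h1)) (lexx _)) _.
rewrite le_eqVlt; apply/orP; left; apply/eqP.
by move: p0 N0 => /lt0r_neq0 p0 /lt0r_neq0 N0; field.
Qed.

End DosMeasure.

(** * Moments of a periodic Jacobi matrix *)

Section PeriodicMoments.
Variable R : realType.
Notation mu := (@lebesgue_measure R).

Lemma exprn_lipschitz (C x y : R) l : 1 <= C -> `|x| <= C -> `|y| <= C ->
  `|x ^+ l - y ^+ l| <= l%:R * C ^+ l * `|x - y|.
Proof.
move=> C1 xC yC; have C0 : 0 <= C by apply: le_trans C1.
elim: l => [|l IH]; first by rewrite !expr0 subrr normr0 !mul0r.
have -> : x ^+ l.+1 - y ^+ l.+1 = x * (x ^+ l - y ^+ l) + (x - y) * y ^+ l.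
  by rewrite !exprS; ring.
apply: le_trans (ler_normD _ _) _; rewrite !normrM normrX.
have h1 : `|x| * `|x ^+ l - y ^+ l| <= C * (l%:R * C ^+ l * `|x - y|).
  by rewrite ler_pM.
have h2 : `|x - y| * `|y| ^+ l <= `|x - y| * C ^+ l.+1.
  rewrite ler_wpM2l // (le_trans (lerXn2r l _ _ yC)) ?nnegrE // exprS.
  by rewrite ler_peMl // exprn_ge0.
apply: le_trans (lerD h1 h2) _.
by rewrite -natr1 exprS le_eqVlt; apply/orP; left; apply/eqP; ring.
Qed.

Variables (p : nat) (a0 b0 : int -> R).
Hypothesis hp : (0 < p)%N.
Hypothesis hJ : periodic_jacobi p a0 b0.
Let D := discriminant p a0 b0.

(** The condition [1 <= C] serves [exprn_lipschitz], where the powers of [C] must not decrease. *)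
Lemma periodic_jacobi_bound : exists C : R, [/\ 1 <= C,
    forall n, `|right_half a0 n| <= C / 3 /\ `|right_half b0 n| <= C / 3 &
    forall N j x, (0 < j < N)%N -> D.[x] = level R N j -> `|x| <= C].
Proof.
have [M hM] := right_half_bounded hp hJ.
have M0 : 0 <= M by apply: le_trans (proj1 (hM 0%N)).
have hM' n : `|right_half a0 n| <= M + 1 /\ `|right_half b0 n| <= M + 1.
  by have [h1 h2] := hM n; split; [apply: le_trans h1 _ | apply: le_trans h2 _]; rewrite lerDl.
exists (3 * (M + 1)); split.
- lra.
- by move=> n; rewrite mulrC mulrA mulVf // mul1r; exact: hM'.
- by move=> N j x; exact: (level_root_bound hp hJ hM').
Qed.

(** [level_power_sum] and [level_sum_integral] evaluate the same sum as [N] times a constant up to a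
    bounded error; letting [N] grow, the constants coincide. *)
Lemma periodic_moment l L : (l <= L)%N ->
  p%:R^-1 * \sum_(i < p) jacobi_diag (right_half a0) (right_half b0) l (L + i) =
  \int[mu]_x (x ^+ l * dos_density p D x).
Proof.
move=> lL; have [C [C1 hC hlev]] := periodic_jacobi_bound.
have C0 : 0 <= C by apply: le_trans C1.
have sz := size_discriminant hp hJ.
have slv := size_level_roots hp hJ hC.
have smp := level_root_simple hp hJ.
have [K1 hK1] := level_power_sum hp hJ hC lL.
have mX : measurable_fun setT (fun x : R => x ^+ l).
  by apply: continuous_measurable_fun; exact: exprn_continuous.
have L0 : 0 <= l%:R * C ^+ l by rewrite mulr_ge0 // exprn_ge0.
have gB (x : R) : `|x| <= C -> `|x ^+ l| <= C ^+ l.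
  by move=> xC; rewrite normrX lerXn2r ?nnegrE.
have [K2 hK2] := level_sum_integral hp sz slv hlev smp mX L0 gB
  (fun x y => @exprn_lipschitz C x y l C1).
set S := \sum_(i < p) _ in hK1 *.
set I := \int[mu]_x _ in hK2 *.
have bnd N : (1 < N)%N -> N%:R * `|S - p%:R * I| <= K1 + K2.
  move=> N1.
  have -> : N%:R * `|S - p%:R * I| = `|N%:R * S - N%:R * (p%:R * I)|.
    by rewrite -mulrBr normrM ger0_norm.
  have := hK1 N (ltnW N1); have := hK2 N N1.
  rewrite -/D; set T := \sum_(1 <= j < N) _.
  rewrite !ler_norml => /andP[h1 h2] /andP[h3 h4].
  by apply/andP; split; lra.
have p0 : (p%:R : R) != 0 by rewrite pnatr_eq0; lia.
suff : S - p%:R * I = 0 by move/eqP; rewrite subr_eq0 => /eqP ->; rewrite mulKf.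
apply/eqP; rewrite -normr_le0 leNgt; apply/negP => pos.
have K0 : 0 <= (K1 + K2) / `|S - p%:R * I|.
  by rewrite divr_ge0 // ?(ltW pos) // (le_trans _ (bnd 2%N isT)) // mulr_ge0.
have := archi_boundP K0; set N := Num.bound _ => hN.
have := bnd N.+2 isT; rewrite leNgt => /negP; apply.
rewrite -ltr_pdivrMr // (lt_trans hN) // ltr_nat; lia.
Qed.

End PeriodicMoments.

(** * Compactness and right limits *)

Section RightLimits.
Variable R : realType.

Lemma bounded_ultra_cvg (U : set_system nat) (u : nat -> R) (M : R) :
  UltraFilter U -> (forall n, `|u n| <= M) -> exists c : R, u @ U --> c.
Proof.
move=> UU uM; have PU : ProperFilter U by exact: ultra_proper.
have UM : (u @ U) [set` `[- M, M]].
  apply: (@filterS _ U _ setT) => [n _ /=|]; last exact: filterT.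
  by rewrite in_itv /= -ler_norml; exact: uM.
have [c [_ clc]] := @segment_compact R (- M) M (u @ U) _ UM.
exists c => B Bc /=.
have [//|UnB] := in_ultra_setVsetC (u @^-1` B) UU.
exfalso; have [x []] := clc (~` B) B UnB Bc.
by [].
Qed.

(** An ultrafilter finer than the filter at infinity makes all coordinates converge at once, in
    place of a diagonal extraction. Indices [h j] are then chosen so that the coordinates from [-j]
    to [j] are within [1 / (j + 1)] of their limits. *)
Lemma bounded_right_limit (a b : nat -> R) (M : R) (f : nat -> nat) :
  (forall n, `|a n| <= M /\ `|b n| <= M) -> (forall n, (n <= f n)%N) ->
  exists h : nat -> nat, exists ar br : int -> R,
    (forall j, (j <= f (h j))%N) /\
    forall k : int,
      ((fun j => extZ a ((f (h j))%:Z + k)) @ \oo --> ar k) /\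
      ((fun j => extZ b ((f (h j))%:Z + k)) @ \oo --> br k).
Proof.
move=> hM hf; have M0 : 0 <= M by apply: le_trans (proj1 (hM 0%N)).
have [U [UU FU]] := @ultraFilterLemma _ (\oo : set_system nat) _.
have PU : ProperFilter U by exact: ultra_proper.
have ext u z : (forall n, `|u n| <= M) -> `|extZ u z| <= M.
  by move=> hu; rewrite /extZ; case: ifP => _; rewrite ?normr0.
have /choice[ar har] k : exists c : R, (fun n => extZ a ((f n)%:Z + k)) @ U --> c.
  by apply: (bounded_ultra_cvg (M := M) UU) => n; apply: ext => m; exact: (hM m).1.
have /choice[br hbr] k : exists c : R, (fun n => extZ b ((f n)%:Z + k)) @ U --> c.
  by apply: (bounded_ultra_cvg (M := M) UU) => n; apply: ext => m; exact: (hM m).2.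
have /choice[h hh] (j : nat) : exists n, (j <= n)%N /\
   forall i : 'I_(j + j).+1, let k := (i : nat)%:Z - j%:Z in
     `|ar k - extZ a ((f n)%:Z + k)| < j.+1%:R^-1 /\
     `|br k - extZ b ((f n)%:Z + k)| < j.+1%:R^-1.
  apply: (@filter_ex _ U); apply: filterI; first by apply: FU; exists j.
  apply: filter_forall => i.
  by apply: filterI; [have /cvgrPdist_lt := har (i%:Z - j%:Z)
    | have /cvgrPdist_lt := hbr (i%:Z - j%:Z)]; apply; rewrite invr_gt0 ltr0n.
exists h, ar, br; split; first by move=> j; rewrite (leq_trans (hh j).1).
have near_k (k : int) (j : nat) : (absz k <= j)%N ->
     `|ar k - extZ a ((f (h j))%:Z + k)| < j.+1%:R^-1 /\
     `|br k - extZ b ((f (h j))%:Z + k)| < j.+1%:R^-1.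
  move=> kj; have lt : (absz (k + j%:Z)%R < (j + j).+1)%N by lia.
  have := (hh j).2 (Ordinal lt) => /=.
  by rewrite (_ : (absz (k + j%:Z)%R)%:Z - j%:Z = k) //; lia.
move=> k; split; apply/cvgrPdist_lt => e e0; near=> j.
- apply: (lt_trans (near_k k j _).1); first by near: j; exact: nbhs_infty_ge.
  by near: j; exact: (near_infty_natSinv_lt (PosNum e0)).
- apply: (lt_trans (near_k k j _).2); first by near: j; exact: nbhs_infty_ge.
  by near: j; exact: (near_infty_natSinv_lt (PosNum e0)).
Unshelve. all: by end_near.
Qed.

Variables (p : nat) (a0 b0 : int -> R).
Hypothesis hp : (0 < p)%N.
Variables (a b : nat -> R).
Hypothesis hbdd : exists M : R, forall n, `|a n| <= M /\ `|b n| <= M.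
Hypothesis hrl : forall ar br : int -> R, is_right_limit a b ar br ->
  in_isospectral_torus p (discriminant p a0 b0) ar br.

Lemma jacobi_diag_average_cvg l :
  (fun n => p%:R^-1 * \sum_(1 <= j < p.+1) jacobi_diag a b l (j + n)) @ \oo -->
  \int[@lebesgue_measure R]_x (x ^+ l * dos_density p (discriminant p a0 b0) x).
Proof.
set s := (X in X @ \oo --> _); set m := (X in _ --> X).
apply: contrapT => ncvg.
have [e e0 he] : exists2 e, 0 < e & forall N, exists n, (N <= n)%N /\ e <= `|m - s n|.
  apply: contrapT => hn; apply: ncvg; apply/cvgrPdist_lt => e e0.
  apply: contrapT => hnear; apply: hn; exists e => // N.
  apply: contrapT => hN; apply: hnear; exists N => // n /= Nn.
  by rewrite ltNge; apply/negP => le; apply: hN; exists n.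
have /choice[f hf] := he.
have [M hM] := hbdd.
have [h [ar [br [hfh hlim]]]] := bounded_right_limit hM (fun n => (hf n).1).
have [hper hdisc] : in_isospectral_torus p (discriminant p a0 b0) ar br.
  apply: hrl; exists (f \o h); split => // N.
  by exists N => j Nj; rewrite (leq_trans Nj) //; exact: hfh.
(* A multiple of [p], so that moving the origin back by [L] leaves the right limit unchanged, and at
   least [l], so that the sites from [L] on do not see the end of the half-line. *)
pose L := (l * p)%N.
have lL : (l <= L)%N by rewrite leq_pmulr.
have perL z : ar (z + L%:Z) = ar z /\ br (z + L%:Z) = br z.
  rewrite /L; elim: (l) z => [|k IH] z; first by rewrite mul0n addr0.
  have -> : z + (k.+1 * p)%:Z = (z + (k * p)%:Z) + p%:Z by lia.
  have [-> ->] := hper.2 (z + (k * p)%:Z); exact: IH.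
pose sh (u : nat -> R) j k := extZ u ((f (h j))%:Z + (k.+1%:Z - L%:Z)).
have cva k : (fun j => sh a j k) @ \oo --> right_half ar k.
  rewrite /right_half -[k.+1%:Z](subrK L%:Z) (perL _).1; exact: (hlim _).1.
have cvb k : (fun j => sh b j k) @ \oo --> right_half br k.
  rewrite /right_half -[k.+1%:Z](subrK L%:Z) (perL _).2; exact: (hlim _).2.
have cvs : (fun j => p%:R^-1 * \sum_(i < p) jacobi_diag (sh a j) (sh b j) l (L + i))
    @ \oo --> m.
  rewrite /m -hdisc -(periodic_moment hp hper lL).
  apply: cvgM; first exact: cvg_cst.
  apply: cvg_big; first exact: add_continuous.
  by move=> i _; exact: jacobi_diag_cvg.
have /cvgrPdist_lt/(_ e e0) cvs' := cvs.
have [N _ hN] := cvs'.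
have := hN (maxn N L) (leq_maxl N L); rewrite /= ltNge => /negP; apply.
(* This keeps the shifted window at nonnegative indices, where [extZ] returns the sequence
   itself. *)
set j := maxn N L; have jL : (L <= f (h j))%N.
  by apply: leq_trans (hfh j); exact: leq_maxr.
suff -> : p%:R^-1 * \sum_(i < p) jacobi_diag (sh a j) (sh b j) l (L + i) = s (f (h j)).
  exact: (hf (h j)).2.
rewrite /s; congr (_ * _); rewrite big_add1 /= big_mkord; apply: eq_bigr => i _.
rewrite (_ : (i.+1 + f (h j) = L + i + ((f (h j)).+1 - L))%N); last by lia.
rewrite /jacobi_diag [RHS]jacobi_col_shift; last by lia.
have shE (u : nat -> R) : sh u j = (fun k => u (k + ((f (h j)).+1 - L))%N).
  apply/funext => k; rewrite /sh /extZ ifT; last by lia.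
  by congr u; lia.
by rewrite !shE.
Qed.

End RightLimits.

(** * Polynomial approximation and convergence from moments *)

Section Weierstrass.
Variable R : realType.

Lemma continuous_bounded_on (f : R -> R) (C : R) : continuous f ->
  exists B : R, forall x, `|x| <= C -> `|f x| <= B.
Proof.
move=> cf; have := compact_bounded (continuous_compact (continuous_subspaceT cf)
  (@segment_compact R (- C) C)).
move=> [B [_ /(_ (B + 1))]]; rewrite ltrDl => /(_ ltr01) hB.
exists (B + 1) => x xC; apply: hB => /=; exists x => //=.
by rewrite in_itv /= -ler_norml.
Qed.

Lemma segment_unif_continuous (f : R -> R) (a b e : R) : continuous f -> 0 < e ->
  exists2 d, 0 < d & forall x y, a <= x <= b -> `|x - y| < d -> `|f x - f y| < e.
Proof.
move=> cf e0; have := @segment_compact R a b.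
move=> /compact_near_coveringP/(_ R (0^'+)
  (fun d x => forall y, `|x - y| < d -> `|f x - f y| < e) _) H.
have : \forall d \near (0 : R)^'+, [set` `[a, b]] `<=`
    (fun x => forall y, `|x - y| < d -> `|f x - f y| < e).
  apply: H => x _.
  have e2 : 0 < e / 2 by rewrite divr_gt0.
  have /cvgrPdist_lt/(_ _ e2)/nbhs_ballP[r /= r0 hr] := cf x.
  have r2 : 0 < r / 2 by rewrite divr_gt0.
  exists (ball x (r / 2), [set d | d < r / 2]) => /=.
    by split; [exact: nbhsx_ballx | exact: nbhs_right_lt].
  move=> [x' d] /= [xx' dr] y x'y.
  have h1 : `|f x - f x'| < e / 2.
    by apply: hr; apply: le_ball xx'; lra.
  have h2 : `|f x - f y| < e / 2.
    apply: hr; rewrite /ball /=.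
    rewrite (splitr r) -(subrK x' x) -addrA (le_lt_trans (ler_normD _ _)) //.
    by rewrite ltrD // (lt_trans x'y).
  rewrite -(subrK (f x) (f x')) -addrA (le_lt_trans (ler_normD _ _)) //.
  by rewrite (splitr e) ltrD // distrC.
move=> hd; have [d [/= d0 hd']] := filter_ex (filterI (nbhs_right_gt (0 : R)) hd).
by exists d => // x y xab; apply: hd'; rewrite /= in_itv.
Qed.

(* [bernstein n h] is the expectation of [h (k)] for [k] binomial with
   parameters [n] and ['X], computed by conditioning on the first trial. *)
Fixpoint bernstein n (h : nat -> R) : {poly R} :=
  if n is m.+1 then
    'X * bernstein m (fun k => h k.+1) + (1 - 'X) * bernstein m h
  else (h 0%N)%:P.

Lemma bernstein_le n (h g : nat -> R) x : 0 <= x <= 1 ->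
  (forall k, (k <= n)%N -> h k <= g k) -> (bernstein n h).[x] <= (bernstein n g).[x].
Proof.
move=> /andP[x0 x1]; elim: n h g => [|n IH] h g hg /=.
  by rewrite !hornerC; exact: hg.
rewrite !hornerE lerD // ler_wpM2l ?subr_ge0 // IH // => k kn; apply: hg => //.
exact: leqW.
Qed.

Lemma bernsteinD n h g : bernstein n (h \+ g) = bernstein n h + bernstein n g.
Proof.
elim: n h g => [|n IH] h g /=; first by rewrite polyCD.
by rewrite (IH (fun k => h k.+1)) IH; ring.
Qed.

Lemma bernsteinZ n c h : bernstein n (fun k => c * h k) = c *: bernstein n h.
Proof.
elim: n h => [|n IH] h /=; first by rewrite polyCM mul_polyC.
by rewrite (IH (fun k => h k.+1)) IH -!mul_polyC; ring.
Qed.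

Lemma bernstein_cst n c : bernstein n (fun=> c) = c%:P.
Proof. by elim: n => [//|n /= ->]; ring. Qed.

(** The free shift [s] closes the induction, because conditioning on a success replaces [k] by
    [k + 1]. With [s = 0] and [c = n x] it is the binomial variance. *)
Lemma bernstein_variance n (s c x : R) :
  (bernstein n (fun k => (k%:R + s - c) ^+ 2)).[x] =
  (n%:R * x + s - c) ^+ 2 + n%:R * x * (1 - x).
Proof.
elim: n s => [|n IH] s /=; first by rewrite hornerC !mul0r addr0.
have -> : (fun k => (k.+1%:R + s - c) ^+ 2) = (fun k => (k%:R + (s + 1) - c) ^+ 2).
  by apply/funext => k; rewrite -natr1; congr (_ ^+ 2); ring.
by rewrite !hornerE !IH -natr1; ring.
Qed.

(** The difference [f y - f x] is dominated by [e / 2 + K (y - x)^2]: near [x] by uniform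
    continuity, far from it by boundedness. Averaging over the binomial points [k / n] turns the
    square into [x (1 - x) / n]. *)
Lemma weierstrass01 (f : R -> R) (e : R) : continuous f -> 0 < e ->
  exists q : {poly R}, forall x, 0 <= x <= 1 -> `|f x - q.[x]| <= e.
Proof.
move=> cf e0; have e2 : 0 < e / 2 by rewrite divr_gt0.
have [d d0 hd] := segment_unif_continuous 0 1 cf e2.
have [B hB'] := continuous_bounded_on 1 cf.
have hB x : 0 <= x <= 1 -> `|f x| <= B.
  by move=> /andP[x0 x1]; apply: hB'; rewrite ger0_norm.
have B0 : 0 <= B by apply: le_trans (hB 0 _) => //; rewrite lexx ler01.
pose K := 2 * B / d ^+ 2.
have K0 : 0 <= K by apply: divr_ge0; [exact: mulr_ge0|exact: sqr_ge0].
have quad x y : 0 <= x <= 1 -> 0 <= y <= 1 -> `|f y - f x| <= e / 2 + K * (y - x) ^+ 2.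
  move=> x01 y01; case: (ltP `|x - y| d) => xy.
    have := hd _ _ x01 xy; rewrite distrC => /ltW/le_trans; apply.
    by rewrite lerDl mulr_ge0 // sqr_ge0.
  apply: le_trans (ler_normB _ _) _; apply: (@le_trans _ _ (2 * B)).
    by have := hB _ x01; have := hB _ y01; lra.
  apply: (@le_trans _ _ (K * (y - x) ^+ 2)); last by rewrite lerDr ltW.
  rewrite /K -mulrA -[X in X <= _]mulr1; apply: ler_wpM2l; first by rewrite mulr_ge0.
  rewrite mulrC ler_pdivlMr ?exprn_gt0 // mul1r -(real_normK (num_real (y - x))).
  by rewrite distrC lerXn2r ?nnegrE // ltW.
pose n := (Num.bound (2 * K / e)).+1.
have n0 : (0 : R) < n%:R by rewrite ltr0n.
have hn : K / n%:R <= e / 2.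
  have b0 : 0 <= 2 * K / e by apply: divr_ge0; [exact: mulr_ge0 | exact: ltW].
  have : 2 * K / e < n%:R.
    by apply: lt_trans (archi_boundP b0) _; rewrite ltr_nat.
  rewrite ltr_pdivrMr // => h; rewrite ler_pdivrMr //; lra.
exists (bernstein n (fun k => f (k%:R / n%:R))) => x x01.
have k01 k : (k <= n)%N -> 0 <= (k%:R / n%:R : R) <= 1.
  move=> kn; apply/andP; split; first exact: divr_ge0.
  by rewrite -(ler_pM2r n0) mul1r divfK ?gt_eqF // ler_nat.
pose v k := e / 2 + K * (k%:R / n%:R - x) ^+ 2.
have vE : (bernstein n v).[x] <= e.
  have -> : v = cst (e / 2) \+ (fun k => (K / n%:R ^+ 2) * (k%:R + 0 - n%:R * x) ^+ 2).
    by apply/funext => k; rewrite /v /=; field; rewrite gt_eqF.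
  rewrite bernsteinD bernsteinZ bernstein_cst hornerD hornerC hornerZ bernstein_variance.
  rewrite addr0 subrr expr0n add0r.
  have -> : K / n%:R ^+ 2 * (n%:R * x * (1 - x)) = (K / n%:R) * (x * (1 - x)).
    by field; rewrite gt_eqF.
  have xx : x * (1 - x) <= 1.
    by case/andP: x01 => x0 x1; rewrite mulr_ile1 ?subr_ge0 // gerBl.
  have : K / n%:R * (x * (1 - x)) <= K / n%:R.
    by rewrite ler_piMr // divr_ge0 // ltW.
  lra.
have up : (bernstein n (fun k => f (k%:R / n%:R))).[x] <= f x + (bernstein n v).[x].
  have := @bernstein_le n (fun k => f (k%:R / n%:R)) (cst (f x) \+ v) x x01.
  rewrite bernsteinD bernstein_cst hornerD hornerC; apply => k /k01 h /=.
  by have := quad _ _ x01 h; rewrite ler_norml => /andP[_]; rewrite /v; lra.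
have lo : f x <= (bernstein n (fun k => f (k%:R / n%:R))).[x] + (bernstein n v).[x].
  have := @bernstein_le n (cst (f x)) ((fun k => f (k%:R / n%:R)) \+ v) x x01.
  rewrite bernsteinD bernstein_cst hornerD hornerC; apply => k /k01 h /=.
  by have := quad _ _ x01 h; rewrite ler_norml => /andP[+ _]; rewrite /v; lra.
by rewrite ler_norml; apply/andP; split; lra.
Qed.

Lemma weierstrass_approximation (f : R -> R) (C e : R) : continuous f -> 0 < C -> 0 < e ->
  exists q : {poly R}, forall x, `|x| <= C -> `|f x - q.[x]| <= e.
Proof.
move=> cf C0 e0; pose l : {poly R} := (2 * C) *: 'X - C%:P.
have cg : continuous (fun t => f l.[t]).
  move=> t; apply: (@continuous_comp _ _ _ (horner l) f); first exact: continuous_horner.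
  exact: cf.
have [q hq] := weierstrass01 cg e0.
exists (q \Po ((2 * C)^-1 *: 'X + (2^-1)%:P)) => x; rewrite ler_norml => /andP[h1 h2].
rewrite horner_comp !hornerE.
have xE : l.[(2 * C)^-1 * x + 2^-1] = x.
  by rewrite /l !hornerE; field; rewrite gt_eqF.
rewrite -{1}xE; apply: hq.
have -> : (2 * C)^-1 * x + 2^-1 = (x + C) / (2 * C) by field; rewrite gt_eqF.
have C2 : 0 < 2 * C by rewrite mulr_gt0.
apply/andP; split; first by apply: divr_ge0; lra.
rewrite ler_pdivrMr //; lra.
Qed.

(** The functionals enter only through their stability under uniform approximation on [[-C, C]], so
    one statement covers both integrals and normalized sums over zeros. *)
Lemma moment_functional_cvg (I : nat -> (R -> R) -> R) (J : (R -> R) -> R) (C : R)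
    (f : R -> R) : 0 < C -> continuous f ->
  (forall n (q : {poly R}) e, 0 < e -> (forall x, `|x| <= C -> `|f x - q.[x]| <= e) ->
    `|I n f - \sum_(i < size q) q`_i * I n (fun x => x ^+ i)| <= e) ->
  (forall (q : {poly R}) e, 0 < e -> (forall x, `|x| <= C -> `|f x - q.[x]| <= e) ->
    `|J f - \sum_(i < size q) q`_i * J (fun x => x ^+ i)| <= e) ->
  (forall l, (fun n => I n (fun x => x ^+ l)) @ \oo --> J (fun x => x ^+ l)) ->
  (fun n => I n f) @ \oo --> J f.
Proof.
move=> C0 cf hI hJ hm; apply/cvgrPdist_lt => e e0.
have e3 : 0 < e / 3 by rewrite divr_gt0.
have [q hq] := weierstrass_approximation cf C0 e3.
have cq : (fun n => \sum_(i < size q) q`_i * I n (fun x => x ^+ i)) @ \oo -->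
    \sum_(i < size q) q`_i * J (fun x => x ^+ i).
  apply: cvg_big; first exact: add_continuous.
  by move=> i _; apply: cvgM; [exact: cvg_cst | exact: hm].
have /cvgrPdist_lt/(_ _ e3) near_q := cq.
near=> n.
have h1 := hI n q _ e3 hq; have h2 := hJ q _ e3 hq.
have h3 : `|\sum_(i < size q) q`_i * J (fun x => x ^+ i) -
  \sum_(i < size q) q`_i * I n (fun x => x ^+ i)| < e / 3 by near: n; exact: near_q.
move: h1 h2 h3; rewrite !ler_norml !ltr_norml => /andP[? ?] /andP[? ?] /andP[? ?].
by apply/andP; split; lra.
Unshelve. all: by end_near.
Qed.

End Weierstrass.

(** * Orthonormal polynomials recovered from the moments *)

Section JacobiMeasure.
Variable R : realType.
Variables (a b : nat -> R).
Hypothesis ha : forall n, 0 < a n.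
Variable mu : {measure set R -> \bar R}.
Hypothesis hmu : forall k : nat,
  mu.-integrable setT (fun x => (x ^+ k)%:E) /\
  (\int[mu]_x (x ^+ k)%:E = (jacobi_moment a b k)%:E)%E.

Let E (q : {poly R}) : R := \int[mu]_x q.[x].

Lemma integrable_poly (q : {poly R}) : mu.-integrable setT (EFin \o horner q).
Proof.
rewrite -(coefK q) poly_def.
apply: (big_ind (fun q : {poly R} => mu.-integrable setT (EFin \o horner q))).
- rewrite (_ : _ \o _ = cst 0%E); first exact: integrable0.
  by apply/funext => x /=; rewrite horner0.
- move=> q1 q2 h1 h2.
  rewrite (_ : _ \o _ = ((EFin \o horner q1) \+ (EFin \o horner q2))%E).
    exact: integrableD.
  by apply/funext => x /=; rewrite hornerD.
- move=> i _; rewrite (_ : _ \o _ = (fun x => (q`_i)%:E * (x ^+ i)%:E)%E).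
    by apply: integrableZl => //; exact: (hmu i).1.
  by apply/funext => x /=; rewrite hornerZ hornerXn.
Qed.

Let ED q r : E (q + r) = E q + E r.
Proof.
rewrite /E -RintegralD //; [|exact: integrable_poly..].
by apply: eq_Rintegral => x _; rewrite hornerD.
Qed.

Let EZ c q : E (c *: q) = c * E q.
Proof.
rewrite /E -RintegralZl //; last exact: integrable_poly.
by apply: eq_Rintegral => x _; rewrite hornerZ.
Qed.

Let E0 : E 0 = 0. Proof. by rewrite -(scale0r 0) EZ mul0r. Qed.

Let Esum n (f : 'I_n -> {poly R}) : E (\sum_i f i) = \sum_i E (f i).
Proof. exact: (big_morph E ED E0). Qed.

Let EXn k : E 'X^k = jacobi_col a b k 0 0.
Proof.
rewrite /E /Rintegral (_ : (fun x => ('X^k).[x]%:E) = (fun x => (x ^+ k)%:E)).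
  by rewrite (hmu k).2 jacobi_moment_col.
by apply/funext => x; rewrite hornerXn.
Qed.

Notation Q := (jacobi_poly a b).

(** Only the straight walk gets from [i + l] to [i] in [l] steps. *)
Lemma jacobi_col_lower l i : jacobi_col a b l (i + l) i = \prod_(k < l) a (i + k).
Proof.
elim: l i => [|l IH] i; first by rewrite big_ord0 addn0 /jacobi_col /= eqxx.
rewrite jacobi_colS /jacobi_apply big_ord_recl addn0.
rewrite (_ : jacobi_col a b l (i + l.+1) i = 0) ?mulr0 ?add0r; last first.
  by apply: jacobi_col_support; lia.
have -> : (match i with 0%N => 0 | m.+1 => a m * jacobi_col a b l (i + l.+1) m end) = 0.
  by case: i => [//|i]; rewrite jacobi_col_support ?mulr0 //; apply/orP; left; lia.
rewrite addr0 -addSnnS IH.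
by congr (_ * _); apply: eq_bigr => k _; congr a; rewrite /= /bump /=; lia.
Qed.

Lemma jacobi_col_upper l : jacobi_col a b l 0 l = \prod_(k < l) a k.
Proof.
elim: l => [|l IH]; first by rewrite big_ord0.
rewrite jacobi_colS /jacobi_apply big_ord_recr /= IH.
by rewrite !jacobi_col_support ?mulr0 ?add0r 1?mulrC //; lia.
Qed.

Lemma lead_jacobi_poly n : lead_coef (Q n) = (\prod_(k < n) a k)^-1.
Proof.
elim: n => [|n IH]; first by rewrite big_ord0 invr1 /jacobi_poly /= lead_coef1.
by rewrite lead_jacobi_polyS // IH big_ord_recr /= invfM mulrC.
Qed.

(** Strong induction: expand ['X^n] in the [Q m] and apply [E]. The term of [Q 0] already equals the
    moment, the middle terms vanish, and [E (Q n)] is left with the nonzero coefficient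
    [a_0 ... a_{n-1}]. *)
Let EQ n : E (Q n) = (n == 0)%:R.
Proof.
have [k] := ubnP n; elim: k n => // k IH [|n] nk.
  have -> : Q 0 = 'X^0 by rewrite /jacobi_poly expr0.
  by rewrite EXn /jacobi_col.
have split_ends (c g : nat -> R) : g 0%N = 1 -> (forall i, (0 < i < n.+1)%N -> g i = 0) ->
    \sum_(i < n.+2) c i * g i = c 0%N + c n.+1 * g n.+1.
  move=> g0 gi; rewrite big_ord_recl big_ord_recr /= g0 mulr1 big1 ?add0r //.
  by move=> i _; rewrite gi ?mulr0 //; have := ltn_ord i; rewrite /bump /=; lia.
have : \sum_(i < n.+2) jacobi_col a b n.+1 0 i * E (Q i) = jacobi_col a b n.+1 0 0.
  rewrite -EXn -[in RHS](mulr1 'X^(n.+1)).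
  have -> : (1 : {poly R}) = Q 0 by [].
  by rewrite (mulXn_jacobi_poly b ha (ltnSn _)) Esum; apply: eq_bigr => i _; rewrite EZ.
rewrite (split_ends _ (fun i => E (Q i))); last 2 first.
- by rewrite IH //; lia.
- by move=> i hi; rewrite IH; last (by lia); case: i hi.
move=> /eqP; rewrite addrC -subr_eq0 addrK mulf_eq0 => /orP[|/eqP //].
by rewrite jacobi_col_upper gt_eqF // prodr_gt0.
Qed.

Let EXnQ l j : E ('X^l * Q j) = jacobi_col a b l j 0.
Proof.
rewrite (mulXn_jacobi_poly b ha (ltnSn (j + l))) Esum big_ord_recl big1 ?addr0.
  by rewrite EZ EQ mulr1.
by move=> i _; rewrite EZ EQ mulr0.
Qed.

Let EMQ (q : {poly R}) n : E (q * Q n) = \sum_(i < size q) q`_i * jacobi_col a b i n 0.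
Proof.
rewrite -{1}(coefK q) poly_def mulr_suml Esum; apply: eq_bigr => i _.
by rewrite -scalerAl EZ EXnQ.
Qed.

Lemma jacobi_poly_orthogonal (q : {poly R}) n : (size q <= n)%N -> E (q * Q n) = 0.
Proof.
move=> qn; rewrite EMQ big1 // => i _; rewrite jacobi_col_support ?mulr0 //.
by have := ltn_ord i; lia.
Qed.

(** Only the top power of the first factor pairs with [Q n]; it yields the product of the bonds,
    whose inverse is the leading coefficient. *)
Lemma jacobi_poly_norm n : E (Q n * Q n) = 1.
Proof.
rewrite EMQ size_jacobi_poly // big_ord_recr big1 ?add0r /=.
  have := jacobi_col_lower n 0; rewrite add0n => ->.
  have -> : (Q n)`_n = lead_coef (Q n) by rewrite /lead_coef size_jacobi_poly.
  by rewrite lead_jacobi_poly mulVf ?add0r // lt0r_neq0 // prodr_gt0.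
move=> i _; rewrite jacobi_col_support ?mulr0 //.
by have := ltn_ord i; lia.
Qed.

Variable P : nat -> {poly R}.
Hypothesis hPdeg : forall n, size (P n) = n.+1.
Hypothesis hPlead : forall n, 0 < lead_coef (P n).
Hypothesis hPorth : forall m n,
  (\int[mu]_x ((P m).[x] * (P n).[x])%:E = ((m == n)%:R)%:E)%E.

Let EPP m n : E (P m * P n) = (m == n)%:R.
Proof.
rewrite /E /Rintegral (_ : (fun x => (P m * P n).[x]%:E) =
  (fun x => ((P m).[x] * (P n).[x])%:E)) ?hPorth //.
by apply/funext => x; rewrite hornerM.
Qed.

Let EPorth n (q : {poly R}) : (size q <= n)%N -> E (q * P n) = 0.
Proof.
have [k] := ubnP (size q); elim: k q => // k IH q qk qn.
have [->|q0] := eqVneq q 0; first by rewrite mul0r E0.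
have s0 : (0 < size q)%N by rewrite size_poly_gt0.
pose m := (size q).-1; pose r := q - (lead_coef q / lead_coef (P m)) *: P m.
have c0 : lead_coef q / lead_coef (P m) != 0.
  by rewrite mulf_neq0 ?invr_eq0 ?(gt_eqF (hPlead m)) // lead_coef_eq0.
have rs : (size r < size q)%N.
  rewrite -(prednK s0) ltnS; apply/leq_sizeP => i; rewrite leq_eqVlt => /predU1P[<-|mi].
    rewrite coefB coefZ -[X in X - _]/(lead_coef q).
    have -> : (P m)`_(size q).-1 = lead_coef (P m) by rewrite /lead_coef hPdeg.
    by rewrite divfK ?subrr // gt_eqF.
  rewrite coefB coefZ !nth_default ?mulr0 ?subrr //.
    by rewrite hPdeg /m (prednK s0) -(prednK s0).
  by rewrite -(prednK s0).
have -> : q = r + (lead_coef q / lead_coef (P m)) *: P m by rewrite /r subrK.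
rewrite mulrDl ED -scalerAl EZ EPP IH ?add0r; last 2 first.
- by rewrite (leq_trans rs).
- by rewrite (leq_trans (ltnW rs)).
by rewrite (_ : m == n = false) ?mulr0 // /m; apply/negbTE; lia.
Qed.

(** With [c] matching the leading coefficients, [P n - c *: Q n] has lower degree and is orthogonal
    to all lower degrees. Pairing it with [P m], where [m] is its degree, would return a nonzero
    multiple of its leading coefficient, so it is 0; norms and signs then give [c = 1]. *)
Lemma orthonormal_jacobi_poly n : P n = Q n.
Proof.
pose c := lead_coef (P n) / lead_coef (Q n).
have lQ := lead_jacobi_poly_gt0 b ha n.
have c0 : 0 < c by rewrite divr_gt0.
pose r := P n - c *: Q n.
have sr : (size r <= n)%N.
  apply/leq_sizeP => i; rewrite leq_eqVlt => /predU1P[<-|ni].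
    rewrite coefB coefZ.
    have -> : (P n)`_n = lead_coef (P n) by rewrite /lead_coef hPdeg.
    have -> : (Q n)`_n = lead_coef (Q n) by rewrite /lead_coef size_jacobi_poly.
    by rewrite /c divfK ?subrr // gt_eqF.
  by rewrite coefB coefZ !nth_default ?mulr0 ?subrr // ?hPdeg ?size_jacobi_poly.
have r_orth (s : {poly R}) : (size s <= n)%N -> E (s * r) = 0.
  move=> sn; rewrite /r mulrBr -scaleN1r ED EZ EPorth // -scalerAr EZ.
  by rewrite jacobi_poly_orthogonal // !mulr0 addr0.
have r0 : r = 0.
  apply/eqP; apply/negPn/negP => r0.
  have s0 : (0 < size r)%N by rewrite size_poly_gt0.
  pose m := (size r).-1.
  pose u := r - (lead_coef r / lead_coef (P m)) *: P m.
  have us : (size u <= m)%N.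
    apply/leq_sizeP => i; rewrite leq_eqVlt => /predU1P[<-|mi].
      rewrite coefB coefZ -[X in X - _]/(lead_coef r).
      have -> : (P m)`_m = lead_coef (P m) by rewrite /lead_coef hPdeg.
      by rewrite divfK ?subrr // gt_eqF.
    by rewrite coefB coefZ !nth_default ?mulr0 ?subrr // ?hPdeg // -(prednK s0).
  have : E (P m * r) = 0 by apply: r_orth; rewrite hPdeg /m prednK.
  have -> : r = u + (lead_coef r / lead_coef (P m)) *: P m by rewrite /u subrK.
  rewrite mulrDr ED -scalerAr EZ EPP eqxx mulr1 mulrC EPorth // add0r => /eqP.
  by rewrite mulf_eq0 invr_eq0 lead_coef_eq0 (negbTE r0) gt_eqF.
have PE : P n = c *: Q n by apply/eqP; rewrite -subr_eq0 -/r r0.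
have := EPP n n; rewrite {1 2}PE -scalerAl -scalerAr !EZ jacobi_poly_norm eqxx !mulr1.
move=> /eqP; rewrite -expr2 sqrp_eq1 ?ltW // => /eqP c1.
by rewrite PE c1 scale1r.
Qed.

Lemma moment_orthonormal l j : E ('X^l * (P j * P j)) = jacobi_diag a b l j.
Proof.
rewrite mulrA orthonormal_jacobi_poly (mulXn_jacobi_poly b ha (ltnSn (j + l))).
rewrite mulr_suml Esum (bigD1 (Ordinal (_ : j < (j + l).+1)%N)) ?ltnS ?leq_addr //= => h.
rewrite -scalerAl EZ -!orthonormal_jacobi_poly EPP eqxx mulr1 big1 ?addr0 // => i.
rewrite -val_eqE /= => ij; rewrite -scalerAl EZ -!orthonormal_jacobi_poly EPP.
by rewrite (negbTE ij) mulr0.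
Qed.

End JacobiMeasure.

(** * Compactly supported densities and the support of a measure *)

Section DensityFunctionals.
Variable R : realType.

(* The variable [X] is the identity in all applications; it lets the same lemmas
   serve both for the measurable structures on [R] and on [measurableTypeR R]. *)
Definition compact_density d (T : measurableType d) (m : {measure set T -> \bar R})
    (X v : T -> R) (C : R) :=
  [/\ forall f : R -> R, continuous f -> measurable_fun setT (fun t => f (X t)),
      m.-integrable setT (EFin \o v), \int[m]_t v t = 1, forall t, 0 <= v t &
      forall t, v t != 0 -> `|X t| <= C].

Variables (d : measure_display) (T : measurableType d).
Variables (m : {measure set T -> \bar R}) (X v : T -> R) (C : R).
Hypothesis mv : compact_density m X v C.

Lemma integrable_density (f : R -> R) : continuous f ->
  m.-integrable setT (EFin \o (fun t => f (X t) * v t)).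
Proof.
move=> cf; have [mX iv _ _ sv] := mv; have [B hB] := continuous_bounded_on C cf.
apply: (@integrable_bounded_mul _ _ _ _ _ _ (fun t => f (X t)) B) => //.
  exact: mX.
by move=> t _ /sv; exact: hB.
Qed.

Lemma density_horner (q : {poly R}) :
  \sum_(i < size q) q`_i * \int[m]_t (X t ^+ i * v t) = \int[m]_t (q.[X t] * v t).
Proof.
have iX (i : nat) : m.-integrable setT (EFin \o (fun t => X t ^+ i * v t)).
  by apply: (integrable_density (f := fun x => x ^+ i)); exact: exprn_continuous.
have gen n : \sum_(i < n) q`_i * \int[m]_t (X t ^+ i * v t) =
    \int[m]_t ((\poly_(i < n) q`_i).[X t] * v t).
  elim: n => [|n IH].
    rewrite big_ord0 (_ : (fun t => _) = cst 0) ?Rintegral_cst ?mul0r //.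
    by apply/funext => t; rewrite poly_def big_ord0 horner0 mul0r.
  rewrite big_ord_recr /= IH -RintegralZl //.
  rewrite -RintegralD //; last 2 first.
  - exact: (integrable_density (@continuous_horner _ _)).
  - rewrite [Z in _.-integrable _ Z](_ : _ =
      (fun t => (q`_n)%:E * (X t ^+ n * v t)%:E)%E) //.
    by apply: integrableZl => //; exact: iX.
  apply: eq_Rintegral => t _.
  by rewrite !poly_def big_ord_recr /= hornerD hornerZ hornerXn mulrDl mulrA.
by rewrite gen coefK.
Qed.

Lemma density_approximation (f : R -> R) (q : {poly R}) (e : R) : continuous f ->
  (forall x, `|x| <= C -> `|f x - q.[x]| <= e) ->
  `|\int[m]_t (f (X t) * v t) - \sum_(i < size q) q`_i * \int[m]_t (X t ^+ i * v t)| <= e.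
Proof.
move=> cf hq; have [mX iv v1 v0 sv] := mv.
rewrite density_horner -RintegralB //; last 2 first.
- exact: integrable_density.
- exact: (integrable_density (@continuous_horner _ _)).
rewrite [Z in `|Z|](_ : _ = \int[m]_t ((f (X t) - q.[X t]) * v t)); last first.
  by apply: eq_Rintegral => t _; rewrite mulrBl.
rewrite -[Z in _ <= Z]mulr1 -v1; apply: norm_Rintegral_bounded_mul => //.
  by apply: measurable_funB; apply: mX => //; exact: continuous_horner.
by move=> t _ /sv; exact: hq.
Qed.

End DensityFunctionals.

Section MeasureSupport.
Variable R : realType.

(** Markov's inequality for the moment of order [2 k] bounds the mass by [(K / C)^(2 k)]; [k = 0]
    gives finiteness and large [k] gives 0. *)
Lemma moments_support (mu : {measure set R -> \bar R}) (K C : R) : 0 <= K < C ->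
  (forall k : nat, (\int[mu]_x (x ^+ (2 * k))%:E <= (K ^+ (2 * k))%:E)%E) ->
  mu [set x | C < `|x|] = 0%E.
Proof.
move=> /andP[K0 KC] hK; have C0 : 0 < C by apply: le_lt_trans KC.
set A := [set x | C < `|x|].
have mA : measurable A.
  have oA : open A.
    apply: (@open_comp _ _ (@Num.norm _ R) [set y | C < y]); last exact: open_gt.
    by move=> x _; exact: norm_continuous.
  exact: open_measurable.
have mX k : measurable_fun setT (fun x : R => (x ^+ (2 * k))%:E).
  by apply/measurable_EFinP; apply: continuous_measurable_fun; exact: exprn_continuous.
have ev0 (x : R) k : 0 <= x ^+ (2 * k) by rewrite exprM exprn_ge0 // sqr_ge0.
have bound k : ((C ^+ (2 * k))%:E * mu A <= (K ^+ (2 * k))%:E)%E.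
  apply: le_trans (hK k); rewrite -integral_cst //.
  apply: (@le_trans _ _ (\int[mu]_(x in A) (x ^+ (2 * k))%:E)%E).
    apply: ge0_le_integral => //.
    - by move=> x _; rewrite /= lee_fin exprn_ge0 // ltW.
    - exact: measurable_funS (mX k).
    - move=> x /= Cx; rewrite lee_fin -[X in _ <= X]ger0_norm ?ev0 // normrX.
      by rewrite lerXn2r ?nnegrE ?(ltW C0) // ltW.
  by apply: ge0_subset_integral => // x _; rewrite lee_fin.
have muA : mu A \is a fin_num.
  have := bound 0%N; rewrite muln0 !expr0 mul1e => h.
  by rewrite ge0_fin_numE // (le_lt_trans h) // ltry.
have r1 : `|(K / C) ^+ 2| < 1.
  rewrite ger0_norm ?sqr_ge0 // expr_lt1 // ?divr_ge0 // ?ltW //.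
  by rewrite ltr_pdivrMr // mul1r.
have le k : fine (mu A) <= ((K / C) ^+ 2) ^+ k.
  have := bound k; rewrite -(fineK muA) -EFinM lee_fin -exprM exprMn exprVn.
  by rewrite ler_pdivlMr ?exprn_gt0 // mulrC.
have := cvg_expr r1 => c0.
have le0 : fine (mu A) <= 0.
  rewrite -(cvg_lim (@Rhausdorff R) c0); apply: limr_ge; first by apply/cvg_ex; exists 0.
  by near=> k; exact: le.
by rewrite -(fineK muA); congr EFin; apply/eqP; rewrite eq_le le0 fine_ge0.
Unshelve. all: by end_near.
Qed.

End MeasureSupport.

(** * Zero counting sums and Cesaro means *)

Section ZeroCounting.
Variable R : realType.

Lemma zero_counting_rootsR n (q : {poly R}) (f : R -> R) : q != 0 ->
  zero_counting_integral n q f = n%:R^-1 * \sum_(x <- rootsR q) f x.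
Proof.
move=> q0; rewrite /zero_counting_integral; congr (_ * _).
rewrite (_ : [set x | root q x] = [set` rootsR q]); last first.
  by apply/seteqP; split => x /=; rewrite mem_rootsR.
by rewrite -fsbig_seq // uniq_rootsR.
Qed.

Lemma bounded_sum_shift (d : nat -> R) (B : R) j n : (forall i, `|d i| <= B) ->
  `|\sum_(k < n) d (j + k)%N - \sum_(k < n) d k| <= j%:R * (2 * B).
Proof.
move=> dB; elim: j => [|j IH].
  by rewrite mul0r subrr normr0.
have E : \sum_(k < n) d (j.+1 + k)%N = \sum_(k < n) d (j + k)%N + d (j + n)%N - d j.
  rewrite -[X in X - _](big_ord_recr n (fun k => d (j + k)%N)) big_ord_recl /= addn0.
  rewrite addrC addrK; apply: eq_bigr => k _; congr d.
  by rewrite /bump /=; lia.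
rewrite E -natr1 mulrDl mul1r.
have := dB j; have := dB (j + n)%N; move: IH; rewrite !ler_norml.
by move=> /andP[? ?] /andP[? ?] /andP[? ?]; apply/andP; split; lra.
Qed.

(** The Cesaro means of [s] tend to [m], and the bounded discrepancy is divided by [n]. *)
Lemma cvg_average_perturbation (u s : nat -> R) (m K : R) : s @ \oo --> m ->
  (forall n, `|u n - \sum_(k < n) s k| <= K) -> (fun n => n%:R^-1 * u n) @ \oo --> m.
Proof.
move=> sm hu; rewrite -cvg_shiftS.
have -> : (fun n => n.+1%:R^-1 * u n.+1) =
   arithmetic_mean s \+ (fun n => n.+1%:R^-1 * (u n.+1 - \sum_(k < n.+1) s k)).
  apply/funext => n; rewrite /arithmetic_mean /series /= big_mkord -mulrDr.
  by rewrite addrC subrK.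
rewrite -(addr0 m); apply: cvgD; first exact: cesaro.
apply/cvgrPdist_le => e e0; have K0 : 0 <= K by apply: le_trans (hu 0%N).
have eK : 0 < e / (K + 1) by rewrite divr_gt0 // ltr_wpDl.
near=> n; rewrite sub0r normrN normrM ger0_norm ?invr_ge0 //.
have h : n.+1%:R^-1 < e / (K + 1) by near: n; exact: (near_infty_natSinv_lt (PosNum eK)).
apply: (@le_trans _ _ (n.+1%:R^-1 * (K + 1))).
  by apply: ler_wpM2l; rewrite ?invr_ge0 // (le_trans (hu _)) // lerDl.
by rewrite -ler_pdivlMr ?ltW // ltr_wpDl.
Unshelve. all: by end_near.
Qed.

End ZeroCounting.

(** * Weak convergence of both families of measures *)

Section WeakLimits.
Variable R : realType.
Variables (p : nat) (a0 b0 : int -> R).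
Hypothesis hp : (0 < p)%N.
Hypothesis hJ0 : periodic_jacobi p a0 b0.
Let Delta := discriminant p a0 b0.
Let w := dos_density p Delta.

(** Every larger [C] is allowed, so that one interval can serve [nu] together with the zeros of
    [p_n] or with [mu]. *)
Lemma dos_compact_density : exists C0 : R, forall C, C0 <= C ->
  compact_density (@lebesgue_measure R) idfun w C.
Proof.
have [C0 [C1 hC hlev]] := periodic_jacobi_bound hp hJ0.
have sz := size_discriminant hp hJ0.
have slv := size_level_roots hp hJ0 hC.
have smp := level_root_simple hp hJ0.
exists C0 => C CC; split.
- by move=> f cf; exact: continuous_measurable_fun.
- exact: (integrable_dos hp sz slv smp).
- by rewrite /Rintegral (dos_mass hp sz slv smp).
- exact: dos_density_ge0.
- by move=> x /(dos_support hp sz slv hlev smp) /le_trans; apply.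
Qed.

Lemma dos_integralE (f : R -> R) : continuous f ->
  dos_integral p Delta f = (\int[@lebesgue_measure R]_x (f x * w x))%:E.
Proof.
move=> cf; have [C hC] := dos_compact_density.
have fin := integrable_fin_num measurableT (integrable_density (hC C (lexx C)) cf).
rewrite /Rintegral fineK // /dos_integral [LHS]integral_mkcond.
apply: eq_integral => x _; rewrite patchE; case: ifPn => // /negP xS.
rewrite /w dos_density_eq0 ?mulr0 // leNgt; apply/negP => h; apply: xS.
rewrite inE /spectrum_of /=; move: h; rewrite ltr_norml => /andP[? ?].
by apply/andP; split; apply: ltW.
Qed.

Variables (a b : nat -> R).
Hypothesis ha : forall n, 0 < a n.
Hypothesis hbdd : exists M : R, forall n, `|a n| <= M /\ `|b n| <= M.
Hypothesis hrl : forall ar br : int -> R, is_right_limit a b ar br ->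
  in_isospectral_torus p (discriminant p a0 b0) ar br.

Lemma zero_counting_cvg (f : R -> R) : continuous f ->
  (fun n => n%:R^-1 * \sum_(x <- rootsR (jacobi_poly a b n)) f x) @ \oo -->
  \int[@lebesgue_measure R]_x (f x * w x).
Proof.
move=> cf; have [M hM] := hbdd; have [C0 hC0] := dos_compact_density.
have M0 : 0 <= M by apply: le_trans (proj1 (hM 0%N)).
pose C := Num.max C0 (3 * M + 1).
have CC0 : C0 <= C by rewrite le_max lexx.
have CM : 3 * M + 1 <= C by rewrite le_max lexx orbT.
have dw := hC0 C CC0.
have rb n x : x \in rootsR (jacobi_poly a b n) -> `|x| <= C.
  rewrite mem_rootsR ?jacobi_poly_neq0 // => /(jacobi_poly_root_bound ha hM).
  by move/le_trans; apply; apply: le_trans CM; rewrite lerDl.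
(* All [n] zeros are real and simple, so for [n > 0] the weights [1 / n] add up to 1. *)
have sr n : size (rootsR (jacobi_poly a b n)) = n.
  rewrite size_rootsR ?jacobi_poly_neq0 ?size_jacobi_poly //.
  exact: jacobi_poly_real_rooted hM n.
apply: (moment_functional_cvg (C := C)
  (I := fun n f => n%:R^-1 * \sum_(x <- rootsR (jacobi_poly a b n)) f x)
  (J := fun f => \int[@lebesgue_measure R]_x (f x * w x))) => //.
- by apply: lt_le_trans CM; rewrite ltr_wpDl // mulr_ge0.
- move=> n q e e0 hq.
  have -> : \sum_(i < size q) q`_i * (n%:R^-1 *
      \sum_(x <- rootsR (jacobi_poly a b n)) x ^+ i) =
      n%:R^-1 * \sum_(x <- rootsR (jacobi_poly a b n)) q.[x].
    under eq_bigr do rewrite mulrCA mulr_sumr.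
    rewrite -mulr_sumr exchange_big /=; congr (_ * _).
    by apply: eq_bigr => x _; rewrite horner_coef.
  rewrite -mulrBr -sumrB normrM ger0_norm ?invr_ge0 //.
  apply: (@le_trans _ _ (n%:R^-1 * (n%:R * e))).
    apply: ler_wpM2l; rewrite ?invr_ge0 //.
    apply: le_trans (ler_norm_sum _ _ _) _.
    rewrite big_seq (@le_trans _ _ (\sum_(x <- rootsR (jacobi_poly a b n)) e)) //.
      by rewrite [X in _ <= X]big_seq; apply: ler_sum => x /rb; exact: hq.
    by rewrite big_const_seq count_predT sr iter_addr_0 mulr_natl.
  (* For [n = 0] the weight is 0 by the convention for the inverse of 0. *)
  have [->|n0] := eqVneq n 0%N; first by rewrite invr0 mul0r ltW.
  by rewrite mulKf // pnatr_eq0.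
- by move=> q e e0 hq; exact: (density_approximation dw cf hq).
move=> l; have hs := jacobi_diag_average_cvg hp hbdd hrl (l := l).
pose B := (3 * M) ^+ l.
have dB i : `|jacobi_diag a b l i| <= B by exact: jacobi_col_bound.
(* The first term is the truncation error of the trace, the second the cost of shifting the diagonal
   sum by up to [p] sites. *)
apply: (cvg_average_perturbation (K := 2 * B * l%:R + p%:R * (2 * B)) hs) => n.
set S := \sum_(x <- _) _; set T := \sum_(k < n) _.
have h1 : `|S - \sum_(i < n) jacobi_diag a b l i| <= 2 * B * l%:R.
  exact: jacobi_poly_power_sum.
have B0 : 0 <= B by rewrite exprn_ge0 // mulr_ge0.
have h2 : `|T - \sum_(i < n) jacobi_diag a b l i| <= p%:R * (2 * B).
  have pp0 : (p%:R : R) != 0 by rewrite pnatr_eq0; lia.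
  have -> : T - \sum_(i < n) jacobi_diag a b l i = p%:R^-1 * \sum_(1 <= j < p.+1)
      (\sum_(k < n) jacobi_diag a b l (j + k) - \sum_(k < n) jacobi_diag a b l k).
    rewrite sumrB sumr_const_nat subn1 /= -[X in _ = _ * (_ - X)]mulr_natl mulrBr mulKf //.
    by rewrite /T -mulr_sumr exchange_big.
  rewrite normrM ger0_norm ?invr_ge0 //.
  apply: (@le_trans _ _ (p%:R^-1 * (p%:R * (p%:R * (2 * B))))); last by rewrite mulKf.
  apply: ler_wpM2l; first by rewrite invr_ge0.
  apply: le_trans (ler_norm_sum _ _ _) _.
  have -> : p%:R * (p%:R * (2 * B)) = \sum_(1 <= j < p.+1) (p%:R * (2 * B)).
    by rewrite sumr_const_nat subn1 mulr_natl.
  apply: ler_sum_nat => j /andP[_ jp].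
  apply: le_trans (bounded_sum_shift j n dB) _.
  by apply: ler_wpM2r; [rewrite mulr_ge0 | rewrite ler_nat].
move: h1 h2; rewrite !ler_norml => /andP[? ?] /andP[? ?].
by apply/andP; split; lra.
Qed.

Variable mu : {measure set R -> \bar R}.
Hypothesis hmu : forall k : nat,
  mu.-integrable setT (fun x => (x ^+ k)%:E) /\
  (\int[mu]_x (x ^+ k)%:E = (jacobi_moment a b k)%:E)%E.
Variable P : nat -> {poly R}.
Hypothesis hPdeg : forall n, size (P n) = n.+1.
Hypothesis hPlead : forall n, 0 < lead_coef (P n).
Hypothesis hPorth : forall m n,
  (\int[mu]_x ((P m).[x] * (P n).[x])%:E = ((m == n)%:R)%:E)%E.

Let V n : {poly R} := p%:R^-1 *: \sum_(1 <= j < p.+1) P (j + n)%N ^+ 2.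

Let V_ge0 n x : 0 <= (V n).[x].
Proof.
rewrite hornerZ horner_sum mulr_ge0 ?invr_ge0 // sumr_ge0 // => j _.
by rewrite horner_exp sqr_ge0.
Qed.

Let V_moment n l : \int[mu]_x (x ^+ l * (V n).[x]) =
  p%:R^-1 * \sum_(1 <= j < p.+1) jacobi_diag a b l (j + n).
Proof.
have lin (r : seq nat) : \int[mu]_x ('X^l * \sum_(j <- r) P (j + n)%N ^+ 2).[x] =
    \sum_(j <- r) jacobi_diag a b l (j + n).
  elim: r => [|j r IH].
    rewrite !big_nil mulr0 (_ : (fun x => _) = cst 0) ?Rintegral_cst ?mul0r //.
    by apply/funext => x; rewrite horner0.
  rewrite !big_cons mulrDr -IH -(moment_orthonormal ha hmu hPdeg hPlead hPorth l (j + n)).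
  rewrite -RintegralD //; [|exact: integrable_poly hmu _..].
  by apply: eq_Rintegral => x _; rewrite hornerD expr2.
rewrite -lin -RintegralZl //; last exact: integrable_poly hmu _.
apply: eq_Rintegral => x _.
by rewrite hornerZ hornerM hornerXn mulrCA.
Qed.

Lemma orthonormal_average_cvg (f : R -> R) : bounded_continuous f ->
  (fun n => \int[mu]_x (f x * (V n).[x])) @ \oo -->
    \int[@lebesgue_measure R]_x (f x * w x) /\
  forall n, mu.-integrable setT (EFin \o (fun x => f x * (V n).[x])).
Proof.
move=> [cf [B hB]]; have [M hM] := hbdd; have [C0 hC0] := dos_compact_density.
have M0 : 0 <= M by apply: le_trans (proj1 (hM 0%N)).
(* The added 1 gives the strict inequality [3 * M < C] that [moments_support] requires. *)
pose C := Num.max C0 (3 * M + 1).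
have CC0 : C0 <= C by rewrite le_max lexx.
have CM : 3 * M + 1 <= C by rewrite le_max lexx orbT.
have dw := hC0 C CC0.
pose S := [set x : R | `|x| <= C].
have cS : ~` S = [set x | C < `|x|].
  by apply/seteqP; split => x /=; rewrite /S /= ltNge => /negP.
have muS : mu (~` S) = 0%E.
  rewrite cS; apply: (@moments_support _ mu (3 * M)).
    by rewrite mulr_ge0 //=; apply: lt_le_trans CM; rewrite ltrDl.
  move=> k; rewrite (hmu (2 * k)).2 lee_fin jacobi_moment_col.
  by apply: le_trans (ler_norm _) _; exact: jacobi_col_bound.
have mS : measurable S.
  have -> : S = [set` `[- C, C]].
    by apply/seteqP; split => x; rewrite /S /= in_itv /= ler_norml.
  exact: measurable_itv.
have iV n : mu.-integrable setT (EFin \o horner (V n)) by exact: integrable_poly hmu _.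
(* The polynomial [V n] need not vanish off [S]; its restriction is a compactly supported density
   with the same integrals, since [mu] does not charge the complement of [S]. *)
pose v n := horner (V n) \_ S.
have vE n (g : R -> R) : mu.-integrable setT (EFin \o (fun x => g x * (V n).[x])) ->
    \int[mu]_x (g x * (V n).[x]) = \int[mu]_x (g x * v n x).
  move=> ig; rewrite {1}/Rintegral (negligible_integral (N := ~` S)) //; last first.
    exact: measurableC.
  rewrite setTD setCK -/(Rintegral _ _ _) Rintegral_mkcond; apply: eq_Rintegral => x _.
  by rewrite /v !patchE; case: ifP => //; rewrite mulr0.
have iXV n l : mu.-integrable setT (EFin \o (fun x => x ^+ l * (V n).[x])).
  rewrite (_ : (fun x => _) = horner ('X^l * V n)); first exact: integrable_poly hmu _.
  by apply/funext => x; rewrite hornerM hornerXn.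
have ifV n : mu.-integrable setT (EFin \o (fun x => f x * (V n).[x])).
  apply: (@integrable_bounded_mul _ _ _ _ _ _ _ B) => //.
  exact: continuous_measurable_fun.
have dv n : compact_density mu idfun (v n) C.
  have i0 : mu.-integrable setT (EFin \o v n).
    have := (integrable_mkcond _ mS).1 (integrableS measurableT mS (@subsetT _ _) (iV n)).
    by rewrite restrict_EFin.
  split => //.
  - by move=> g cg; exact: continuous_measurable_fun.
  - have := vE n (fun x => x ^+ 0) (iXV n 0%N); rewrite V_moment.
    rewrite (_ : (fun x => x ^+ 0 * v n x) = v n); last first.
      by apply/funext => x; rewrite expr0 mul1r.
    move=> <-; rewrite (eq_bigr (fun=> 1)); last first.
      by move=> j _; rewrite /jacobi_diag /jacobi_col /= eqxx.
    by rewrite sumr_const_nat subn1 mulVf // pnatr_eq0; lia.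
  - by move=> x; rewrite /v patchE; case: ifP.
  - move=> x; rewrite /v patchE; case: ifPn; last by rewrite eqxx.
    by rewrite inE.
split => //; under eq_fun do rewrite vE //.
apply: (moment_functional_cvg (C := C)
  (I := fun n f => \int[mu]_x (f x * v n x))
  (J := fun f => \int[@lebesgue_measure R]_x (f x * w x))) => //.
- by apply: lt_le_trans CM; rewrite ltr_wpDl // mulr_ge0.
- by move=> n q e e0 hq; exact: (density_approximation (dv n) cf hq).
- by move=> q e e0 hq; exact: (density_approximation dw cf hq).
move=> l; have hs := jacobi_diag_average_cvg hp hbdd hrl (l := l).
by under eq_fun do rewrite -vE // V_moment.
Qed.

End WeakLimits.

Theorem theorem8p1 (R : realType)
    (* the two-sided p-periodic Jacobi matrix J0 *)
    (p : nat) (a0 b0 : int -> R)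
    (hp : (0 < p)%N) (hJ0 : periodic_jacobi p a0 b0)
    (* the one-sided Jacobi matrix J (0-based parameters) *)
    (a b : nat -> R)
    (ha : forall n, 0 < a n)
    (hbdd : exists M : R, forall n, `|a n| <= M /\ `|b n| <= M)
    (hrl : forall ar br : int -> R, is_right_limit a b ar br ->
             in_isospectral_torus p (discriminant p a0 b0) ar br)
    (* its spectral measure mu *)
    (mu : {measure set R -> \bar R})
    (hmu : forall k : nat,
       mu.-integrable setT (fun x => (x ^+ k)%:E) /\
       (\int[mu]_x (x ^+ k)%:E = (jacobi_moment a b k)%:E)%E)
    (* its orthonormal polynomials *)
    (P : nat -> {poly R})
    (hPdeg : forall n, size (P n) = n.+1)
    (hPlead : forall n, 0 < lead_coef (P n))
    (hPorth : forall m n,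
       (\int[mu]_x ((P m).[x] * (P n).[x])%:E = ((m == n)%:R)%:E)%E) :
  (* (a) *)
  (forall f : R -> R, bounded_continuous f ->
     (fun n : nat =>
        (\int[mu]_x
           (f x * ((p%:R)^-1 * \sum_(1 <= j < p.+1) ((P (j + n)%N).[x]) ^+ 2))%:E)%E)
     @ \oo --> dos_integral p (discriminant p a0 b0) f)
  /\
  (* (b) *)
  (forall f : R -> R, bounded_continuous f ->
     (fun n : nat => (zero_counting_integral n (P n) f)%:E)
     @ \oo --> dos_integral p (discriminant p a0 b0) f).

Proof.
split=> f [cf hf]; rewrite dos_integralE //.
  have [cv int] := orthonormal_average_cvg hp hJ0 ha hbdd hrl hmu hPdeg hPlead hPorth
    (conj cf hf).
  have VE n x : f x * (p%:R^-1 * \sum_(1 <= j < p.+1) ((P (j + n)%N).[x]) ^+ 2) =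
      f x * (p%:R^-1 *: \sum_(1 <= j < p.+1) P (j + n)%N ^+ 2).[x].
    rewrite hornerZ horner_sum; congr (_ * (_ * _)).
    by apply: eq_bigr => j _; rewrite horner_exp.
  under eq_fun => n do under eq_integral => x _ do rewrite VE.
  apply: cvg_EFin; last exact: cv.
  (* The limit is taken in the extended reals, so the integrals must be known to be finite. *)
  by near=> n; apply: integrable_fin_num (int n).
apply: cvg_EFin; first by near=> n.
have -> : fine \o (fun n => (zero_counting_integral n (P n) f)%:E) =
    (fun n => n%:R^-1 * \sum_(x <- rootsR (jacobi_poly a b n)) f x).
  apply/funext => n /=; rewrite (orthonormal_jacobi_poly ha hmu hPdeg hPlead hPorth).
  by rewrite zero_counting_rootsR // jacobi_poly_neq0.
exact: zero_counting_cvg.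
Unshelve. all: by end_near.
Qed.
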